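(* Let $m$ be an odd prime and let $K$ be a cyclic Galois field extension of degree $m$ of a local nonarchimedean field $F$ of residual characteristic $p$, such that $\mu_m\subset F$ and $m\neq p$. Let $q$ denote the order of the residue field of $F$. Then $F^\times/N_{K/F}(K^\times)$ is represented by $$\mathcal{C}_K=\begin{cases}\{1,\varpi,\varpi^2,\dots,\varpi^{m-1}\}&\text{if }K/F\text{ is unramified};\\ \mu_m(F)&\text{if }K/F\text{ is ramified and }m^2\nmid(q-1);\\ \{1,\xi,\xi^2,\dots,\xi^{m-1}\}&\text{if }K/F\text{ is ramified and }m^2\mid(q-1),\end{cases}$$ where $\xi\in\mu_{q-1}(F)$ is any choice of primitive $(q-1)$th root of unity in $F$.
   Context: A local nonarchimedean field is a finite extension of $\mathbb{Q}_p$ or a field of Laurent series over a finite field of characteristic $p$. $\varpi$ is a fixed generator of the maximal ideal of its ring of integers; the residual characteristic is the characteristic of the residue field. $N_{K/F}$ is the field norm; $\mu_n$ denotes the group of $n$th roots of unity in a fixed algebraic closure of $F$ and $\mu_n(F)=\mu_n\cap F$. *)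

(* Defs.v *)
From HB Require Import structures.
From mathcomp Require Import all_boot all_order all_algebra all_fingroup.
From mathcomp Require Import all_solvable all_field.

Set Implicit Arguments.
Unset Strict Implicit.
Unset Printing Implicit Defensive.

Import Order.TTheory GRing.Theory Num.Theory.
Local Open Scope ring_scope.

Definition padic_val (p : nat) (r : rat) : int :=
  (logn p `|numq r|%N)%:Z - (logn p `|denq r|%N)%:Z.

(* Valuations are int-valued functions whose value at 0 is irrelevant;
   [val_ge v N x] reads "v(x) >= N" with v(0) = +oo. *)
Definition val_ge (E : fieldType) (v : E -> int) (N : int) (x : E) : bool :=
  (x == 0) || (N <= v x).

(* (E, iota, v) is the completion of rat for the p-adic valuation: v extends
   the p-adic valuation along iota, iota has dense image and E is complete. *)
Record is_Qp (p : nat) (E : fieldType) (iota : {rmorphism rat -> E})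
    (v : E -> int) : Prop := IsQp {
  Qp_prime : prime p;
  Qp_valM : forall x y : E, x != 0 -> y != 0 -> v (x * y) = v x + v y;
  Qp_valD : forall (N : int) (x y : E),
    val_ge v N x -> val_ge v N y -> val_ge v N (x + y);
  Qp_val_rat : forall r : rat, r != 0 -> v (iota r) = padic_val p r;
  Qp_dense : forall (x : E) (N : int), exists r : rat, val_ge v N (x - iota r);
  Qp_complete : forall u : nat -> E,
    (forall N : int, exists n0 : nat, forall i j : nat,
       (n0 <= i)%N -> (n0 <= j)%N -> val_ge v N (u i - u j)) ->
    exists l : E, forall N : int, exists n0 : nat, forall i : nat,
       (n0 <= i)%N -> val_ge v N (u i - l)
}.

Definition vanishes_below (k : fieldType) (N : int) (a : int -> k) : Prop :=
  forall n : int, n < N -> a n = 0.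

(* E is the field of Laurent series over k: taking coefficients identifies E
   with the functions int -> k vanishing below some index, with pointwise
   addition and Cauchy product.  In the product formula M and N are arbitrary
   lower bounds for the supports of x and y, so that the infinite convolution
   becomes a finite sum; letting M decrease, the formula covers all indices. *)
Record is_laurent (k : finFieldType) (E : fieldType) (coef : E -> int -> k) :
    Prop := IsLaurent {
  laurent_bounded : forall x : E, exists N : int, vanishes_below N (coef x);
  laurent_inj : forall x y : E, coef x =1 coef y -> x = y;
  laurent_surj : forall (a : int -> k) (N : int),
    vanishes_below N a -> exists x : E, coef x =1 a;
  laurentD : forall (x y : E) (n : int), coef (x + y) n = coef x n + coef y n;
  laurentM : forall (x y : E) (M N : int),
    vanishes_below M (coef x) -> vanishes_below N (coef y) ->
    forall n : nat, coef (x * y) (M + N + n%:Z) =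
      \sum_(i < n.+1) coef x (M + i%:Z) * coef y (N + (n - i)%N%:Z)
}.

Definition integral_closure (A B : fieldType) (f : {rmorphism A -> B})
    (O : A -> Prop) (x : B) : Prop :=
  exists P : {poly A},
    [/\ P \is monic, forall i : nat, O P`_i & root (map_poly f P) x].

(* F is a nonarchimedean local field with ring of integers O (a subset of F):
   either F is, up to an isomorphism f, a finite extension L of some Q_p, and O
   is the integral closure of Z_p; or F = k((t)) with k finite, and O = k[[t]].
*)
Inductive local_field (F : fieldType) (O : F -> Prop) : Prop :=
| LocalFieldQp (p : nat) (Qp : fieldType) (iota : {rmorphism rat -> Qp})
    (v : Qp -> int) (L : fieldExtType Qp) (f : {rmorphism L -> F}) of
    is_Qp p iota v & bijective f &
    (forall x : L, O (f x) <-> integral_closure (in_alg L) (val_ge v 0) x)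
| LocalFieldLaurent (k : finFieldType) (coef : F -> int -> k) of
    is_laurent coef &
    (forall x : F, O x <-> vanishes_below 0 (coef x)).

(* The nonunits of O; the case x = 0 is explicit because 0^-1 = 0. *)
Definition max_ideal (E : fieldType) (O : E -> Prop) (x : E) : Prop :=
  O x /\ (x = 0 \/ ~ O x^-1).

Definition uniformizer (E : fieldType) (O : E -> Prop) (w : E) : Prop :=
  forall x : E, max_ideal O x <-> exists2 y : E, O y & x = w * y.

(* k is the residue field of O, with reduction map res; the values of res
   outside O are irrelevant. *)
Record is_residue_field (E : fieldType) (O : E -> Prop) (k : fieldType)
    (res : E -> k) : Prop := IsResidueField {
  res1 : res 1 = 1;
  resD : forall x y : E, O x -> O y -> res (x + y) = res x + res y;
  resM : forall x y : E, O x -> O y -> res (x * y) = res x * res y;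
  res_surj : forall z : k, exists2 x : E, O x & res x = z;
  res_ker : forall x : E, O x -> (res x = 0 <-> max_ideal O x)
}.

Definition is_alg_closure (F : fieldType) (Fbar : closedFieldType)
    (j : {rmorphism F -> Fbar}) : Prop :=
  forall z : Fbar, algebraicOver j z.

(* The ring of integers of K is the integral closure of O. Ramification index
   1: the maximal ideal of O generates that of the ring of integers of K. As
   residue fields are finite, separability of the residue extension is
   automatic. *)
Definition unramified (F : fieldType) (O : F -> Prop) (K : fieldExtType F) :
    Prop :=
  forall w : F, uniformizer O w ->
    uniformizer (integral_closure (in_alg K) O) (w%:A).

Definition norm_group (F : fieldType) (K : splittingFieldType F) (a : F) :
    Prop :=
  exists2 y : K, y != 0 & galNorm 1 {:K} y = a%:A.

(* C is a complete set of representatives of F^* modulo its subgroup N. *)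
Definition represents (F : fieldType) (C N : F -> Prop) : Prop :=
  (forall c : F, C c -> c != 0) /\
  (forall x : F, x != 0 -> exists! c : F, C c /\ N (x / c)).

(* Main.v *)
Require Import Defs.
From HB Require Import structures.
From mathcomp Require Import all_boot all_order all_algebra all_fingroup.
From mathcomp Require Import all_solvable all_field.
From mathcomp Require Import boolp ring zify.

(** Write [O] for the ring of integers of [F], [k] for its residue field with
    [q] elements, [r = (q - 1) / m], and [N] for the group of norms from [K].
    As [F] contains the [m]-th roots of unity, [m] divides [q - 1], and the
    [r]-th power map identifies the nonzero elements of [k] modulo [m]-th powers
    with the [m]-th roots of unity in [k].  As [m] is prime to the
    residual characteristic, principal units (congruent to 1) are [m]-th powers
    in [F]; so a unit of [O] is an [m]-th power in [F] as soon as its residue is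
    one in [k] ([unit_power]).  All [m]-th powers are norms.

    By Kummer theory [K = F(alpha)] with [b = alpha^m] in [F], and since [m] is
    odd the norm of [alpha] is [b] ([norm_root]).  After changing [alpha], the
    element [b] is either a unit whose residue is not an [m]-th power or a
    uniformizer ([kummer_dichotomy]).

    If [b] is a unit, [X^m - b] is irreducible over [k], and every nonzero
    element of [K] is a power of a uniformizer [w] of [F] times a unit of the
    ring of integers of [K] ([unramified_unit_times_power]).  So [K] is
    unramified, and the valuation of a norm is a multiple of [m].  All units of
    [F] are norms, because [b] generates them modulo [m]-th powers.  Hence the
    powers of a uniformizer represent the quotient by [N].

    If [b] is a uniformizer, every nonzero element of [K] is [c * alpha^i] with
    [c] in [F] times a principal unit ([ramified_leading_monomial]).  So [K] is
    ramified, and a unit that is a norm is an [m]-th power in [k]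
    ([ramified_norm_residue]).  Hence the quotient by [N] is that of the nonzero
    elements of [k] by [m]-th powers.  It is represented by the powers of a unit
    [e] whenever the [r]-th power of the residue of [e] has order [m].  This
    holds for a primitive [(q - 1)]-th root of unity, and for a primitive [m]-th
    root of unity if [m] does not divide [r].

    It remains to see that [O] is a discrete valuation ring and that principal
    units are [m]-th powers ([local_field_structure]).  The [m]-th root of
    [1 + z] is the value at [z] of the binomial series of [(1 + X)^(1/m)], whose
    coefficients are polynomials in [1/m] with integer coefficients.  For
    Laurent series both facts are direct.  For an extension [L] of [Qp] with
    uniformizer [w], the nonunits of the integral closure are the multiples of
    [w], and from this a monic equation of [w] shows that [p] divides a power of
    [w].  So every nonunit [z] satisfies an equation of Eisenstein type, and the
    series converges in [Zp[z]], coordinate by coordinate. *)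

Set Implicit Arguments.
Unset Strict Implicit.
Unset Printing Implicit Defensive.

Import Order.TTheory GRing.Theory Num.Theory.
Local Open Scope ring_scope.

(** * Integral closure of a subring *)

(** [local_field] and [integral_closure] describe subrings by [Prop]-valued
    predicates, so closure under the ring operations is a hypothesis here. *)
Definition subring (A : fieldType) (O : A -> Prop) : Prop :=
  [/\ O 1, forall x y, O x -> O y -> O (x - y)
    & forall x y, O x -> O y -> O (x * y)].

Section Subring.
Variables (A : fieldType) (O : A -> Prop).
Hypothesis ringO : subring O.

Lemma subring1 : O 1. Proof. by case: ringO. Qed.
Lemma subringB x y : O x -> O y -> O (x - y). Proof. by case: ringO => _ + _; apply. Qed.
Lemma subringM x y : O x -> O y -> O (x * y). Proof. by case: ringO => _ _; apply. Qed.
Lemma subring0 : O 0. Proof. by rewrite -(subrr 1); apply: subringB subring1 subring1. Qed.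
Lemma subringN x : O x -> O (- x).
Proof. by rewrite -[- x]add0r; apply/subringB/subring0. Qed.
Lemma subringD x y : O x -> O y -> O (x + y).
Proof. by move=> Ox Oy; rewrite -[y]opprK; apply/subringB/subringN. Qed.
Lemma subringX x n : O x -> O (x ^+ n).
Proof.
by move=> Ox; elim: n => [|n IHn]; rewrite ?exprS; [apply: subring1|apply: subringM].
Qed.
Lemma subring_nat n : O n%:R.
Proof.
elim: n => [|n IHn]; first exact: subring0.
by rewrite -natr1; apply: subringD subring1.
Qed.
Lemma subring_sum (I : Type) (r : seq I) (P : pred I) (F : I -> A) :
  (forall i, P i -> O (F i)) -> O (\sum_(i <- r | P i) F i).
Proof. by move=> OF; elim/big_ind: _ => //; [apply: subring0|apply: subringD]. Qed.
Lemma subring_prod (I : Type) (r : seq I) (P : pred I) (F : I -> A) :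
  (forall i, P i -> O (F i)) -> O (\prod_(i <- r | P i) F i).
Proof. by move=> OF; elim/big_ind: _ => //; [apply: subring1|apply: subringM]. Qed.

(** The type of elements of [O], with its commutative ring structure, is what
    allows polynomials over [O] and the theory of [integralOver] to be used. *)
Definition subring_pred of subring O : {pred A} := [pred x | `[<O x>]].

Fact subring_pred_closed : subring_closed (subring_pred ringO).
Proof.
split=> [|x y|x y]; rewrite !inE; first exact/asboolP/subring1.
  by move=> /asboolP Ox /asboolP Oy; apply/asboolP/subringB.
by move=> /asboolP Ox /asboolP Oy; apply/asboolP/subringM.
Qed.

HB.instance Definition _ :=
  GRing.isSubringClosed.Build A (subring_pred ringO) subring_pred_closed.

Definition subring_type := {x : A | subring_pred ringO x}.

HB.instance Definition _ := SubType.on subring_type.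
HB.instance Definition _ := Choice.on subring_type.
HB.instance Definition _ := [SubChoice_isSubComNzRing of subring_type by <:].

Lemma subring_val (x : subring_type) : O (val x).
Proof. by case: x => y /= /asboolP. Qed.

Lemma subring_lift_poly (P : {poly A}) : (forall i, O P`_i) ->
  exists Q : {poly subring_type}, map_poly val Q = P.
Proof.
move=> OP; pose h : A -> subring_type := insubd (0 : subring_type).
have h0 : h 0 = 0 by apply: val_inj; rewrite val_insubd; case: ifP.
have hK y : O y -> val (h y) = y.
  by move=> Oy; rewrite val_insubd; case: ifP => // /asboolP.
by exists (map_poly h P); apply/polyP=> i; rewrite coef_map coef_map_id0 // [LHS]hK.
Qed.

Variables (B : fieldType) (f : {rmorphism A -> B}).

Let g : {rmorphism subring_type -> B} := f \o val.

Lemma integral_closureE x : integral_closure f O x <-> integralOver g x.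
Proof.
split=> [[P [mP OP Px]]|[P mP Px]]; last first.
  exists (map_poly val P); split; first exact: monic_map.
    by move=> i; rewrite coef_map; case: (P`_i) => y /= /asboolP.
  by rewrite -map_poly_comp.
have [Q defP] := subring_lift_poly OP; exists Q.
  rewrite monicE; apply/eqP/val_inj; rewrite /= -(monicP mP) -[in RHS]defP.
  by rewrite lead_coef_map_inj //; apply: val_inj.
by move: Px; rewrite -{1}defP -(map_poly_comp f val).
Qed.

Lemma integral_closure_subring : subring (integral_closure f O).
Proof.
split=> [|x y|x y].
- exact/integral_closureE/integral1.
- move=> /integral_closureE Ix /integral_closureE Iy.
  exact/integral_closureE/integral_sub.
- move=> /integral_closureE Ix /integral_closureE Iy.
  exact/integral_closureE/integral_mul.
Qed.

Lemma integral_closure_id a : O a -> integral_closure f O (f a).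
Proof.
move=> Oa; exists ('X - a%:P); split; first exact: monicXsubC.
  move=> i; rewrite coefB coefX coefC.
  by apply: subringB; [apply: subring_nat|case: ifP => // _; apply: subring0].
by rewrite map_polyXsubC root_XsubC.
Qed.

Lemma integral_closure_root n x a :
  (0 < n)%N -> O a -> x ^+ n = f a -> integral_closure f O x.
Proof.
move=> n0 Oa xn; exists ('X^n - a%:P); split; first exact: monicXnsubC.
  move=> i; rewrite coefB coefXn coefC.
  by apply: subringB; [apply: subring_nat|case: ifP => // _; apply: subring0].
by rewrite rmorphB /= map_polyXn map_polyC /= /root !hornerE xn subrr.
Qed.

End Subring.

(** * Extracting roots of principal units *)

Lemma exprD_second_order (R : comNzRingType) (x y : R) m :
  exists w, (x + y) ^+ m = x ^+ m + m%:R * x ^+ m.-1 * y + y ^+ 2 * w.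
Proof.
elim: m => [|m [w IHm]]; first by exists 0; rewrite !expr0; ring.
case: m => [|m] in IHm *; first by exists 0; rewrite !expr1 expr0; ring.
exists (m.+1%:R * x ^+ m + (x + y) * w); rewrite exprS IHm /=.
rewrite [x ^+ m.+2]exprS [x ^+ m.+1]exprS -[m.+2%:R]natr1; ring.
Qed.

(** The binomial series of [(1 + X)^(1/m)] has coefficients in every ring where
    [m] is invertible: if a truncation is correct up to degree [n], the
    coefficient of degree [n + 1] enters the [m]-th power linearly, with
    factor [m]. *)
Lemma formal_root_one_plus_X (R : comNzRingType) (m : nat) (u : R) :
    (0 < m)%N -> m%:R * u = 1 ->
  exists c : nat -> R, forall n, exists Q : {poly R},
    (\poly_(k < n) c k) ^+ m = 1 + 'X + 'X^n * Q.
Proof.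
move=> m0 mu.
pose T (S : {poly R}) n := (S ^+ m)`_n - (1 + 'X : {poly R})`_n.
pose S := fix S n : {poly R} :=
  if n is n'.+1 then S n' - (u * T (S n') n) *: 'X^n else 1.
have S0 n : (S n)`_0 = 1.
  elim: n => [|n IHn]; first by rewrite coef1.
  by rewrite /= coefB coefZ coefXn IHn mulr0 subr0.
have coefS n : forall i, (i <= n)%N -> T (S n) i = 0.
  elim: n => [|n IHn] i.
    by rewrite leqn0 => /eqP->; rewrite /T expr1n coefD coefX addr0 subrr.
  move=> le_i; rewrite /T /=; set a := u * _.
  have [w ->] := exprD_second_order (S n) (- (a *: 'X^(n.+1))) m.
  set G := - a%:P * (m%:R * S n ^+ m.-1 - (a *: 'X^(n.+1)) * w).
  have -> : S n ^+ m + m%:R * S n ^+ m.-1 * - (a *: 'X^(n.+1))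
      + (- (a *: 'X^(n.+1))) ^+ 2 * w = S n ^+ m + G * 'X^(n.+1).
    by rewrite /G -!mul_polyC; ring.
  rewrite coefD coefMXn; have [lt_in|] := ltnP i n.+1.
    by rewrite addr0 -[RHS](IHn i).
  move=> ge_in; have -> : i = n.+1 by apply/eqP; rewrite eqn_leq le_i.
  have -> : G`_(n.+1 - n.+1) = - (u * m%:R) * T (S n) n.+1.
    have coef0X (P : {poly R}) k : (P ^+ k)`_0 = P`_0 ^+ k.
      by rewrite -!horner_coef0 horner_exp.
    rewrite subnn /G coef0M coefB !coef0M coefN coefC eqxx.
    rewrite -polyC_natr coefC eqxx coef0X S0 expr1n coefZ coefXn.
    by rewrite mulr0 mul0r /a; ring.
  by rewrite [u * _]mulrC mu /T; ring.
exists (fun k => (S k)`_k) => n.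
have defS k : \poly_(i < k.+1) (S i)`_i = S k.
  elim: k => [|k IHk].
    apply/polyP=> i; rewrite coef_poly /= coef1; case: i => [|i] //=.
    by rewrite coef1.
  apply/polyP=> i; rewrite coef_poly ltnS leq_eqVlt.
  have [->|ne_ik] /= := eqVneq i k.+1; first by [].
  rewrite coefB coefZ coefXn (negPf ne_ik) mulr0 subr0.
  by rewrite -[in RHS]IHk coef_poly.
case: n => [|n].
  exists (- 1 - 'X); rewrite poly_def big_ord0 expr0n eqn0Ngt m0 /= expr0; ring.
rewrite defS; exists (drop_poly n.+1 (S n ^+ m - 1 - 'X)).
apply/polyP=> i; rewrite coefD coefXnM; have [lt_in|le_ni] := ltnP i n.+1.
  by apply/eqP; rewrite addr0 -subr_eq0; apply/eqP/coefS.
by rewrite coef_drop_poly subnK // -coefD -[_ - 1 - 'X]addrA -opprD [_ + (_ - _)]addrC subrK.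
Qed.

Lemma eval_formal_root (R : comNzRingType) (E : fieldType)
    (v : {rmorphism R -> E}) (z : E) (c : nat -> R) (m K : nat) (Q : {poly R}) :
    (\poly_(k < K) c k) ^+ m = 1 + 'X + 'X^K * Q ->
  (\sum_(k < K) v (c k) * z ^+ k) ^+ m = 1 + z + z ^+ K * (map_poly v Q).[z].
Proof.
move=> /(congr1 (fun P => (map_poly v P).[z])).
rewrite /= rmorphXn !rmorphD rmorphM rmorph1 /= map_polyX map_polyXn.
rewrite horner_exp !hornerD !hornerM hornerXn hornerX hornerC => <-.
congr (_ ^+ m); rewrite poly_def raddf_sum horner_sum; apply: eq_bigr => k _.
by rewrite /= map_polyZ map_polyXn hornerZ hornerXn.
Qed.

(** Evaluating the formal series at [z].  The coefficients of the series live in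
    a subring [C] and only series with coefficients in [C] are required to
    converge: for Laurent series [C] is the whole valuation ring, while over
    the p-adics it is [Z_p], where completeness is given.  Convergence is
    measured by a separated filtration [I], to be thought of as the powers of
    an ideal. *)
Lemma root_of_one_plus (E : fieldType) (C O : E -> Prop) (I : nat -> E -> Prop)
    (m : nat) (z : E) :
    (0 < m)%N -> subring C -> subring O -> (forall x, C x -> O x) ->
    C m%:R^-1 -> m%:R != 0 :> E ->
    (forall n x y, I n x -> I n y -> I n (x - y)) ->
    (forall n x y, O x -> I n y -> I n (x * y)) ->
    (forall x, (forall n, I n x) -> x = 0) ->
    O z ->
    (forall n, exists N, forall K, (N <= K)%N -> I n (z ^+ K)) ->
    (forall c : nat -> E, (forall k, C (c k)) ->
      exists2 l, O l & forall n, exists N, forall K, (N <= K)%N ->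
        I n (l - \sum_(k < K) c k * z ^+ k)) ->
  exists l, l ^+ m = 1 + z.
Proof.
move=> m0 ringC ringO CO Cm m_neq0 IB IM I0 Oz zI complete.
pose R : comNzRingType := subring_type ringC.
pose v : {rmorphism R -> E} := val.
have um : m%:R * (exist _ m%:R^-1 (asboolT Cm) : R) = 1.
  by apply: val_inj; rewrite [LHS](rmorphM v) rmorph_nat /= mulfV.
have [c cP] := formal_root_one_plus_X m0 um.
have Cval (x : R) : C (val x) by case: x => x /= /asboolP.
have [l Ol lP] := complete (fun k => val (c k)) (fun k => Cval (c k)).
exists l; apply/eqP; rewrite -subr_eq0; apply/eqP/I0 => n.
have [N1 zN1] := zI n; have [N2 lN2] := lP n.
pose K := maxn N1 N2.
have {lN2} := lN2 K (leq_maxr _ _); set s := (X in I n (l - X)) => lsI.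
have [Q /(eval_formal_root v z)] := cP K; rewrite -/s => sm.
have Os : O s.
  by apply: subring_sum => // k _; apply: subringM (subringX _ _ Oz) => //; apply/CO/Cval.
have -> : l ^+ m - (1 + z) = (\sum_(i < m) l ^+ (m.-1 - i) * s ^+ i) * (l - s)
    - (- (map_poly v Q).[z] * z ^+ K).
  by rewrite [_ * (l - s)]mulrC -subrXX sm; ring.
apply: IB; apply: IM => //; last exact/zN1/leq_maxl.
  by apply: subring_sum => // i _; apply: subringM => //; apply: subringX.
apply: subringN => //; rewrite horner_coef; apply: subring_sum => // i _.
apply: subringM => //; last exact: subringX.
by rewrite coef_map; apply/CO/Cval.
Qed.

(** * Discrete valuations *)

(** An element of valuation 1 is required so that [v] is normalised: the
    uniformizers are then the elements of valuation 1. *)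
Record discrete_valuation (F : fieldType) (O : F -> Prop) (v : F -> int) : Prop :=
  DiscreteValuation {
    dval_ring : subring O;
    dvalM : forall x y, x != 0 -> y != 0 -> v (x * y) = v x + v y;
    dval_int : forall x, x != 0 -> O x <-> 0 <= v x;
    dval_surj : exists2 t, t != 0 & v t = 1
  }.

Lemma max_ideal_inv (F : fieldType) (O : F -> Prop) x :
  x != 0 -> O x^-1 -> ~ max_ideal O x.
Proof. by move=> x0 OV [_ [/eqP|]]; first rewrite (negPf x0). Qed.

Section DiscreteValuation.
Variables (F : fieldType) (O : F -> Prop) (v : F -> int).
Hypothesis dv : discrete_valuation O v.
Let ringO := dval_ring dv.

Lemma dval1 : v 1 = 0.
Proof.
have := dvalM dv (oner_neq0 F) (oner_neq0 F); rewrite mulr1 => /eqP.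
by rewrite -subr_eq subrr => /eqP.
Qed.

Lemma dvalV x : x != 0 -> v x^-1 = - v x.
Proof.
move=> x0; apply/eqP; rewrite -addr_eq0 addrC -(dvalM dv) ?invr_eq0 //.
by rewrite mulfV // dval1.
Qed.

Lemma dvalN x : x != 0 -> v (- x) = v x.
Proof.
move=> x0; have n10 : (-1 : F) != 0 by rewrite oppr_eq0 oner_neq0.
have := dvalM dv n10 n10; rewrite mulrNN mulr1 dval1 => vN1.
by rewrite -mulN1r (dvalM dv) //; lia.
Qed.

Lemma dval_div x y : x != 0 -> y != 0 -> v (x / y) = v x - v y.
Proof. by move=> x0 y0; rewrite (dvalM dv) ?invr_eq0 // dvalV. Qed.

Lemma dvalXn x (n : nat) : x != 0 -> v (x ^+ n) = n%:Z * v x.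
Proof.
move=> x0; elim: n => [|n IHn]; first by rewrite dval1 mul0r.
by rewrite exprS (dvalM dv) ?expf_neq0 // IHn intS mulrDl mul1r.
Qed.

Lemma dvalXz x (n : int) : x != 0 -> v (x ^ n) = n * v x.
Proof.
move=> x0; case: n => n; first exact: dvalXn.
by rewrite NegzE -invr_expz dvalV ?expfz_neq0 // [v _]dvalXn // mulNr.
Qed.

Lemma dval_max_ideal x : x != 0 -> max_ideal O x <-> 0 < v x.
Proof.
move=> x0; have xV0 : x^-1 != 0 by rewrite invr_eq0.
rewrite /max_ideal (dval_int dv x0) (dval_int dv xV0) dvalV //.
split=> [[vx [/eqP|/negP]]|vx]; first by rewrite (negPf x0).
  by rewrite oppr_ge0 -ltNge.
by split; [exact: ltW|right; apply/negP; rewrite oppr_ge0 -ltNge].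
Qed.

Lemma dval_uniformizer w : uniformizer O w <-> w != 0 /\ v w = 1.
Proof.
have [t t0 vt] := dval_surj dv.
split=> [wP|[w0 vw] x].
  have : max_ideal O t by apply/dval_max_ideal; rewrite ?vt.
  move=> /wP[y Oy def_t].
  have w0 : w != 0 by apply: contra_eq_neq def_t => ->; rewrite mul0r.
  have y0 : y != 0 by apply: contra_eq_neq def_t => ->; rewrite mulr0.
  split=> //; have : max_ideal O w.
    by apply/wP; exists 1; rewrite ?mulr1 //; apply: subring1.
  move/(dval_max_ideal w0); have /(dval_int dv y0) := Oy.
  by have := dvalM dv w0 y0; rewrite -def_t vt; lia.
have [-> | x0] := eqVneq x 0.
  split=> _; last by split; [apply: subring0|left].
  by exists 0; rewrite ?mulr0 //; apply: subring0.
have xw0 : x / w != 0 by rewrite mulf_neq0 ?invr_eq0.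
split=> [/(dval_max_ideal x0) vx|[y Oy def_x]]; last first.
  have y0 : y != 0 by move: x0; rewrite def_x mulf_eq0 negb_or => /andP[].
  apply/dval_max_ideal => //; rewrite def_x (dvalM dv) // vw.
  by move/(dval_int dv y0): Oy; lia.
exists (x / w); last by rewrite mulrC divfK.
by apply/(dval_int dv xw0); rewrite dval_div // vw; lia.
Qed.

Lemma dval_max_idealM x y : O x -> max_ideal O y -> max_ideal O (x * y).
Proof.
move=> Ox my; have [Oy _] := my.
have Oxy := subringM ringO Ox Oy.
have [->|] := eqVneq (x * y) 0; first by split; [exact: subring0|left].
move=> xy0; have := xy0; rewrite mulf_eq0 negb_or => /andP[x0 y0].
apply/dval_max_ideal => //; rewrite (dvalM dv) //.
by move/(dval_max_ideal y0): my; move/(dval_int dv x0): Ox; lia.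
Qed.

Lemma dval_max_idealB x y : max_ideal O x -> max_ideal O y -> max_ideal O (x - y).
Proof.
have [t t0 vt] := dval_surj dv; have tP := (dval_uniformizer t).2 (conj t0 vt).
move=> /tP[a Oa ->] /tP[b Ob ->]; apply/tP; exists (a - b); last by rewrite mulrBr.
exact: subringB.
Qed.

Lemma dval_one_plus z :
  max_ideal O z -> [/\ 1 + z != 0, O (1 + z) & O (1 + z)^-1].
Proof.
move=> mz; have [Oz _] := mz.
have O1z : O (1 + z) by apply: (subringD ringO) Oz; apply: subring1.
have nm : ~ max_ideal O (1 + z).
  move=> m1z; have : max_ideal O 1 by rewrite -(addrK z 1); apply: dval_max_idealB.
  by apply: max_ideal_inv; rewrite ?oner_neq0 ?invr1 //; apply: subring1.
have z1 : 1 + z != 0.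
  by apply/eqP=> z1; apply: nm; split; [|left].
by split=> //; apply: contrapT => nO; apply: nm; split; [|right].
Qed.

Lemma dval_max_idealX x n : O x -> max_ideal O (x ^+ n) -> max_ideal O x.
Proof.
move=> Ox [_ mx]; split=> //; have [->|x0] := eqVneq x 0; [by left|right=> OxV].
have [/eqP|] := mx; first by rewrite expf_eq0 (negPf x0) andbF.
by apply; rewrite -exprVn; apply: subringX.
Qed.

Lemma dval_int_root n x : (0 < n)%N -> O (x ^+ n) -> O x.
Proof.
move=> n0; have [->|x0] := eqVneq x 0; first by move=> _; apply: subring0.
rewrite (dval_int dv x0) (dval_int dv (expf_neq0 n x0)) dvalXn //.
by rewrite pmulr_rge0 // ltz_nat.
Qed.

Lemma dval_integrally_closed (B : fieldType) (f : {rmorphism F -> B}) x :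
  integral_closure f O (f x) -> O x.
Proof.
move=> [P [mP OP]]; rewrite fmorph_root /root horner_coef => /eqP Px.
apply: contrapT => nOx.
have x0 : x != 0 by apply: contra_notN nOx => /eqP->; apply: subring0.
have xV0 : x^-1 != 0 by rewrite invr_eq0.
have vx : v x < 0 by rewrite ltNge; apply/negP => /(dval_int dv x0).
have OV : O x^-1 by apply/(dval_int dv xV0); rewrite dvalV //; lia.
have szP : (0 < size P)%N by rewrite size_poly_gt0 monic_neq0.
case defn: (size P) szP Px => [//|n] _; rewrite big_ord_recr /=.
have -> : P`_n = 1 by rewrite -(monicP mP) lead_coefE defn.
rewrite mul1r => /eqP; rewrite addrC addr_eq0 => /eqP xn.
have n0 : (0 < n)%N.
  case: n xn {defn} => // /eqP; rewrite big_ord0 oppr0 expr0.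
  by rewrite oner_eq0.
apply: nOx; have -> : x = - \sum_(i < n) P`_i * x^-1 ^+ (n.-1 - i).
  apply: (mulIf (expf_neq0 n.-1 x0)); rewrite -exprS prednK // xn mulNr.
  congr (- _); rewrite mulr_suml; apply: eq_bigr => i _; rewrite -mulrA.
  congr (_ * _); have le_i : (i <= n.-1)%N by rewrite -ltnS prednK.
  by rewrite exprVn -[X in _ * x ^+ X](subnK le_i) exprD mulKf ?expf_neq0.
apply: subringN => //; apply: subring_sum => // i _.
by apply: subringM => //; apply: subringX.
Qed.

End DiscreteValuation.

(** * Fields of Laurent series *)

Section Laurent.
Variables (k : finFieldType) (F : fieldType) (coef : F -> int -> k).
Hypothesis lF : is_laurent coef.

Local Notation below N x := (vanishes_below N (coef x)).

Let coef0 n : coef 0 n = 0.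
Proof.
have /eqP := laurentD lF 0 0 n; rewrite addr0 -subr_eq subrr eq_sym.
by move/eqP.
Qed.

Let coefB x y n : coef (x - y) n = coef x n - coef y n.
Proof. by apply/eqP; rewrite eq_sym subr_eq -(laurentD lF) subrK. Qed.

Let belowB N x y : below N x -> below N y -> below N (x - y).
Proof. by move=> Vx Vy n ltn; rewrite coefB Vx ?Vy ?subrr. Qed.

Let below_le M N x : M <= N -> below N x -> below M x.
Proof. by move=> leMN Vx n ltn; apply/Vx/lt_le_trans/leMN. Qed.

(** For arbitrary lower bounds of the supports only the lowest coefficient of a
    product is simple; it determines the valuation of the product. *)
Let coefM0 M N x y : below M x -> below N y ->
  coef (x * y) (M + N) = coef x M * coef y N.
Proof.
move=> Vx Vy; have := laurentM lF Vx Vy 0.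
by rewrite big_ord_recl big_ord0 /= subnn !addr0.
Qed.

Let belowM M N x y : below M x -> below N y -> below (M + N) (x * y).
Proof.
move=> Vx Vy n ltn; have lt_M : n - N < M by lia.
have := coefM0 (below_le (ltW lt_M) Vx) Vy.
by rewrite subrK => ->; rewrite Vx ?mul0r.
Qed.

Lemma laurent_valuation : exists2 v : F -> int,
    discrete_valuation (fun x => below 0 x) v
  & forall x n, x != 0 -> below n x <-> n <= v x.
Proof.
have /choice[v vP] : forall x, exists N, x != 0 -> below N x /\ coef x N != 0.
  move=> x; have [->|x0] := eqVneq x 0; first by exists 0.
  have [N Vx] := laurent_bounded lF x.
  have exi : exists i : nat, coef x (N + i%:Z) != 0.
    apply: contrapT => /forallNP nx; apply: (negP x0); apply/eqP.
    apply: (laurent_inj lF) => n; rewrite coef0.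
    have [/Vx//|le_n] := ltP n N.
    have := nx `|n - N|%N; have -> : N + `|n - N|%N = n by lia.
    by move/negP/negPn/eqP.
  have [j xj minj] := ex_minnP exi.
  exists (N + j%:Z) => _; split=> // n ltn; have [/Vx//|le_n] := ltP n N.
  apply: contraTeq ltn => xn; have := minj `|n - N|%N.
  have -> : N + `|n - N|%N = n by lia.
  by move/(_ xn); lia.
have vE x N : x != 0 -> below N x -> coef x N != 0 -> v x = N.
  move=> x0 Vx xN; have [Vv xv] := vP x x0.
  have [ltv|] := ltP (v x) N; first by rewrite Vx ?eqxx in xv.
  rewrite le_eqVlt => /orP[/eqP//|ltN].
  by rewrite Vv ?eqxx in xN.
have vle x n : x != 0 -> below n x <-> n <= v x.
  move=> x0; have [Vv xv] := vP x x0; split=> [Vx|le_n]; last exact: below_le Vv.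
  by rewrite leNgt; apply: contra_neqN xv; apply: Vx.
have vM x y : x != 0 -> y != 0 -> v (x * y) = v x + v y.
  move=> x0 y0; have [[Vx xv] [Vy yv]] := (vP x x0, vP y y0).
  by apply: vE; rewrite ?mulf_neq0 //; [exact: belowM|rewrite coefM0 ?mulf_neq0].
have v1 : v 1 = 0.
  have := vM _ _ (oner_neq0 F) (oner_neq0 F); rewrite mulr1 => /eqP.
  by rewrite -subr_eq subrr => /eqP.
exists v => //; split=> //.
- split=> [|x y Ox Oy|x y Ox Oy]; last by rewrite -[0]addr0; apply: belowM.
    by apply/vle; rewrite ?oner_neq0 ?v1.
  exact: belowB.
- by move=> x x0; apply: vle.
have [|t tP] := @laurent_surj _ _ _ lF (fun n => (n == 1)%:R) 1.
  by move=> n; rewrite lt_neqAle => /andP[/negPf->].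
have t0 : t != 0.
  by apply: contra_eq_neq (tP 1) => ->; rewrite coef0 eqxx eq_sym oner_neq0.
exists t => //; apply: vE; rewrite ?tP ?eqxx ?oner_neq0 //.
by move=> n; rewrite tP lt_neqAle => /andP[/negPf->].
Qed.

(** A series in [z] converges because its coefficient of index [n] is already
    that of any partial sum with more than [n] terms. *)
Lemma laurent_root_one_plus m z :
    (0 < m)%N -> below 0 m%:R^-1 -> m%:R != 0 :> F ->
    max_ideal (fun x => below 0 x) z ->
  exists l, l ^+ m = 1 + z.
Proof.
move=> m0 Om m_neq0 mz; have [v dv vle] := laurent_valuation.
have ringO := dval_ring dv; have [Oz _] := mz.
have Vz : below 1 z.
  have [->|z0] := eqVneq z 0; first by move=> n _; rewrite coef0.
  by apply/vle => //; move/(dval_max_ideal dv z0): mz.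
have VzK K : below K%:Z (z ^+ K).
  elim: K => [|K IHK]; first exact: subring1 ringO.
  by rewrite exprS intS; apply: belowM.
apply: (@root_of_one_plus F (fun x => below 0 x) (fun x => below 0 x)
          (fun n x => below n%:Z x)) => //.
- by move=> n x y; apply: belowB.
- by move=> n x y Ox Vy; rewrite -[n%:Z]add0r; apply: belowM.
- move=> x Vx; apply: (laurent_inj lF) => n; rewrite coef0.
  by apply: (Vx `|n|.+1%N); lia.
- by move=> n; exists n => K leK; apply: below_le (VzK K); rewrite lez_nat.
move=> c Oc; pose s K := \sum_(k < K) c k * z ^+ k.
have Os K : below 0 (s K).
  by apply: (subring_sum ringO) => i _; apply: (subringM ringO (Oc i)); apply: (subringX ringO).
have Vs K K' : (K <= K')%N -> below K%:Z (s K' - s K).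
  move=> leK; elim: K' leK => [|K' IHK'].
    by rewrite leqn0 => /eqP->; rewrite subrr => n _; rewrite coef0.
  rewrite leq_eqVlt => /predU1P[<-|ltK].
    by rewrite subrr => n _; rewrite coef0.
  have -> : s K'.+1 - s K = s K' - s K - (0 - c K' * z ^+ K').
    by rewrite /s big_ord_recr /=; ring.
  apply: belowB; first exact: IHK'.
  apply: belowB => [n _|]; first by rewrite coef0.
  apply: (@below_le _ K'); first by rewrite lez_nat.
  by rewrite -[K'%:Z]add0r; apply: belowM.
have [|l lP] := @laurent_surj _ _ _ lF (fun n => coef (s `|n|.+1%N) n) 0.
  by move=> n; apply: Os.
exists l; first by move=> n ltn; rewrite lP Os.
move=> n; exists n => K leK i lti; rewrite coefB lP -/(s K) -coefB.
have [i0|] := ltP i 0; first by rewrite coefB !Os ?subrr.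
move=> i0; rewrite -opprB -sub0r coefB coef0 (Vs `|i|.+1%N) ?subrr //; lia.
Qed.

End Laurent.

(** * Finite extensions of the p-adic numbers *)

(** Dividing a nonzero element repeatedly by [w] must stop, and it stops
    at an element that is not a multiple of [w], which is a unit; so every
    nonzero element is a power of [w] times a unit. *)
Lemma valuation_of_uniformizer (F : fieldType) (O : F -> Prop) (w : F) :
    subring O -> uniformizer O w -> w != 0 ->
    (forall x, exists a b, [/\ O a, O b, b != 0 & x = a / b]) ->
    (forall x, (forall n, exists2 y, O y & x = w ^+ n * y) -> x = 0) ->
  exists v, discrete_valuation O v.
Proof.
move=> ringO wP w0 frac sep.
have Ow : O w by have [] := (wP w).2 (ex_intro2 _ _ 1 (subring1 ringO) (esym (mulr1 w))).
have nOV : ~ O w^-1.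
  have [_ []//] := (wP w).2 (ex_intro2 _ _ 1 (subring1 ringO) (esym (mulr1 w))).
  by move/eqP; rewrite (negPf w0).
pose Uw (x : F) (n : int) := O (x / w ^ n) /\ O (x / w ^ n)^-1.
have UwB x y m n : Uw x m -> Uw y n -> Uw (x / y) (m - n).
  move=> [Ox OxV] [Oy OyV]; rewrite /Uw.
  have -> : x / y / w ^ (m - n) = (x / w ^ m) / (y / w ^ n).
    by rewrite expfzDr // -invr_expz !invfM !invrK; ring.
  by move: Ox OxV Oy OyV; set X := x / _; set Y := y / _ => *; rewrite invf_div;
    split; apply: (subringM ringO).
have UwM x y m n : Uw x m -> Uw y n -> Uw (x * y) (m + n).
  move=> [Ox OxV] [Oy OyV]; rewrite /Uw.
  have -> : x * y / w ^ (m + n) = (x / w ^ m) * (y / w ^ n).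
    by rewrite expfzDr // invfM; ring.
  by move: Ox OxV Oy OyV; set X := x / _; set Y := y / _ => *; rewrite invfM;
    split; apply: (subringM ringO).
have UwO x : O x -> x != 0 -> exists n : int, Uw x n.
  move=> Ox x0; pose D (n : nat) := exists2 y, O y & x = w ^+ n * y.
  have [n Dn nDn] : exists2 n, D n & ~ D n.+1.
    apply: contrapT => nD; move/negP: x0; apply; apply/eqP/sep.
    elim=> [|n IHn]; first by exists x; rewrite ?mul1r.
    by apply: contrapT => nDn; apply: nD; exists n.
  have [y Oy def_x] := Dn; exists n%:Z.
  have -> : Uw x n%:Z = Uw y 0.
    by rewrite /Uw def_x -exprnP [_ * y]mulrC mulfK ?expf_neq0 // expr0z divr1.
  rewrite /Uw expr0z divr1; split=> //.
  apply: contrapT => nOy; apply: nDn.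
  have /wP[t Ot def_y] : max_ideal O y by split; [|right].
  by exists t; rewrite // def_x def_y exprSr mulrA.
have /choice[v vP] : forall x, exists n, x != 0 -> Uw x n.
  move=> x; have [->|x0] := eqVneq x 0; first by exists 0.
  have [a [b [Oa Ob b0 def_x]]] := frac x.
  have a0 : a != 0 by apply: contra_neq x0 => a0; rewrite def_x a0 mul0r.
  have [[m Um] [n Un]] := (UwO a Oa a0, UwO b Ob b0).
  by exists (m - n) => _; rewrite def_x; apply: UwB.
have w_int n : O (w ^ n) -> 0 <= n.
  case: n => // n; rewrite NegzE -exprz_inv => On; case: nOV.
  have -> : w^-1 = w^-1 ^ n.+1 * w ^+ n by rewrite -exprnP exprS -mulrA -exprMn mulVf // expr1n mulr1.
  by apply: (subringM ringO) => //; apply: (subringX ringO).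
have vE x n : x != 0 -> Uw x n -> v x = n.
  move=> x0 Ux; have [[O1 O2] [O3 O4]] := (vP x x0, Ux).
  have E a b : x / w ^ a * (x / w ^ b)^-1 = w ^ (b - a).
    by rewrite expfzDr // -invr_expz invfM invrK; field; rewrite x0 expfz_neq0.
  have /w_int : O (w ^ (n - v x)) by rewrite -E; apply: (subringM ringO).
  have /w_int : O (w ^ (v x - n)) by rewrite -E; apply: (subringM ringO).
  by lia.
exists v; split=> //.
- by move=> x y x0 y0; apply: vE; rewrite ?mulf_neq0 //; apply: UwM; apply: vP.
- move=> x x0; have [Ox OxV] := vP x x0; split=> [Oxx|vx].
    apply: w_int; have -> : w ^ v x = x * (x / w ^ v x)^-1.
      by rewrite invfM invrK mulrA mulfV // mul1r.
    exact: (subringM ringO).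
  rewrite -(divfK (expfz_neq0 (v x) w0) x); apply: (subringM ringO) => //.
  by case: (v x) vx => // n _; rewrite -exprnP; apply: (subringX ringO).
exists w => //; apply: vE => //; rewrite /Uw expr1z mulfV // invr1.
by split; apply: (subring1 ringO).
Qed.

Section Padic.
Variables (p : nat) (Qp E : fieldType) (iota : {rmorphism rat -> Qp}).
Variables (v : Qp -> int) (h : {rmorphism Qp -> E}).
Hypothesis QpP : is_Qp p iota v.
Hypothesis alg_h : forall x, algebraicOver h x.

Local Notation Zp := (val_ge v 0).
Local Notation O := (integral_closure h Zp).

Let p_pr : prime p := Qp_prime QpP.

Lemma padic_val_p : v p%:R = 1.
Proof.
have p0 : p%:R != 0 :> rat by rewrite pnatr_eq0 -lt0n prime_gt0.
rewrite -(rmorph_nat iota) (Qp_val_rat QpP p0) /padic_val -[p%:R]/(p%:~R).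
by rewrite numq_int denq_int absz_nat logn1 -[X in logn _ X]expn1 pfactorK.
Qed.

Lemma padic_valuation : discrete_valuation Zp v.
Proof.
have vM := Qp_valM QpP; have n10 : (-1 : Qp) != 0 by rewrite oppr_eq0 oner_neq0.
have v1 : v 1 = 0.
  have := vM _ _ (oner_neq0 Qp) (oner_neq0 Qp); rewrite mulr1 => /eqP.
  by rewrite -subr_eq subrr => /eqP.
have vN1 : v (-1) = 0 by have := vM _ _ n10 n10; rewrite mulrNN mulr1 v1; lia.
have Zint x : x != 0 -> Zp x <-> 0 <= v x by move=> x0; rewrite /val_ge (negPf x0).
have ZM x y : Zp x -> Zp y -> Zp (x * y).
  have [->|x0] := eqVneq x 0; first by rewrite mul0r.
  have [->|y0] := eqVneq y 0; first by rewrite mulr0.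
  by rewrite !Zint ?mulf_neq0 // vM //; lia.
split=> //.
  split=> //; first by rewrite Zint ?oner_neq0 ?v1.
  move=> x y Zx Zy; apply: (Qp_valD QpP) => //; rewrite -mulN1r.
  by apply: ZM => //; rewrite Zint ?vN1.
exists p%:R; last exact: padic_val_p.
by rewrite -(rmorph_nat iota) fmorph_eq0 pnatr_eq0 -lt0n prime_gt0.
Qed.

Let dvQ := padic_valuation.
Let ringZ := dval_ring dvQ.
Let ringO : subring O := integral_closure_subring ringZ h.

Let p_neq0 : p%:R != 0 :> Qp.
Proof. by rewrite -(rmorph_nat iota) fmorph_eq0 pnatr_eq0 -lt0n prime_gt0. Qed.

Let P : E := p%:R.

Let P_neq0 : P != 0. Proof. by rewrite /P -(rmorph_nat h) fmorph_eq0. Qed.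

Let OP : O P. Proof. exact: subring_nat. Qed.

Let nOPV : ~ O P^-1.
Proof.
rewrite /P -(rmorph_nat h) -fmorphV => /(dval_integrally_closed dvQ).
rewrite (dval_int dvQ) ?invr_eq0 // (dvalV dvQ) // padic_val_p.
by lia.
Qed.

Let Oh a : Zp a -> O (h a). Proof. exact: (integral_closure_id ringZ h). Qed.

Let val_geP N (x : Qp) : val_ge v N%:Z x -> exists2 y, Zp y & x = p%:R ^+ N * y.
Proof.
have [->|x0] := eqVneq x 0.
  by exists 0; [rewrite /val_ge eqxx|rewrite mulr0].
have pN0 : p%:R ^+ N != 0 :> Qp by rewrite expf_neq0.
rewrite /val_ge (negPf x0) /= => le_N; exists (x / p%:R ^+ N).
  apply/(dval_int dvQ); first by rewrite mulf_neq0 ?invr_eq0.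
  by rewrite (dval_div dvQ) // (dvalXn dvQ) // padic_val_p; lia.
by rewrite mulrC divfK.
Qed.

(** If [p^s] clears the denominators in a monic equation of [x] over [Qp], then
    [p^s * x] satisfies a monic equation over [Zp]. *)
Let denominator x : exists s, O (P ^+ s * x).
Proof.
have [q q0] := alg_h x; rewrite /root horner_coef => /eqP qx.
have szq : (0 < size q)%N by rewrite size_poly_gt0.
rewrite size_map_poly in qx.
case defn: (size q) szq qx => [//|n] _; rewrite big_ord_recr /= => qx.
have ln0 : lead_coef q != 0 by rewrite lead_coef_eq0.
pose r i := q`_i / lead_coef q.
have rx : x ^+ n = - \sum_(i < n) h (r i) * x ^+ i.
  have hl0 : h (lead_coef q) != 0 by rewrite fmorph_eq0.
  apply: (mulfI hl0); rewrite mulrN mulr_sumr; apply/eqP; rewrite -addr_eq0 addrC.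
  rewrite -[X in _ == X]qx; apply/eqP; congr (_ + _).
    apply: eq_bigr => i _; rewrite coef_map mulrA -rmorphM; congr (h _ * _).
    by rewrite /r mulrC divfK.
  by rewrite coef_map lead_coefE defn.
have [s sP] : exists s : nat, forall i : 'I_n, Zp (p%:R ^+ s * r i).
  exists (\max_(i < n) `|v (r i)|)%N => i.
  have [ri0|ri0] := eqVneq (r i) 0; first by rewrite ri0 mulr0 /val_ge eqxx.
  apply/(dval_int dvQ); first by rewrite mulf_neq0 ?expf_neq0.
  rewrite (dvalM dvQ) ?expf_neq0 // (dvalXn dvQ) // padic_val_p.
  have : (`|v (r i)| <= \max_(j < n) `|v (r j)|)%N by apply: leq_bigmax.
  by move: (\max_(j < n) _)%N => M; lia.
exists s; case: n => [|n] in rx sP defn qx *.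
  by move/eqP: rx; rewrite big_ord0 oppr0 expr0 oner_eq0.
exists ('X^(n.+1) + \poly_(i < n.+1) (p%:R ^+ s * r i * (p%:R ^+ s) ^+ (n - i))).
split.
- by rewrite monicE lead_coefDl ?lead_coefXn // size_polyXn ltnS size_poly.
- move=> i; rewrite coefD coefXn coef_poly; apply: (subringD ringZ).
    exact: (subring_nat ringZ).
  case: ifP => lti; last exact: (subring0 ringZ).
  apply: (subringM ringZ); first exact: (sP (Ordinal lti)).
  by do 2!apply: (subringX ringZ); exact: (subring_nat ringZ).
rewrite /root rmorphD /= map_polyXn !hornerE exprMn rx.
rewrite (@horner_coef_wide _ n.+1); last first.
  by rewrite size_map_poly size_poly.
rewrite mulrN mulr_sumr addrC subr_eq0; apply/eqP/eq_bigr => i _.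
rewrite coef_map coef_poly ltn_ord /= !(rmorphM, rmorphXn) /= rmorph_nat -/P.
have le_in : (i <= n)%N by rewrite -ltnS.
rewrite exprS; have -> : (P ^+ s) ^+ n = (P ^+ s) ^+ (n - i) * (P ^+ s) ^+ i.
  by rewrite -exprD subnK.
by rewrite [in LHS]exprMn; ring.
Qed.

Let padic_separated x :
  (forall n, exists2 y, O y & x = P ^+ n * y) -> x = 0.
Proof.
move=> divx; have [//|x0] := eqVneq x 0.
have [s Os] := denominator x^-1; have [y Oy def_x] := divx s.+1.
case: nOPV; have -> : P^-1 = P ^+ s * x^-1 * y; last exact: subringM.
have y0 : y != 0 by apply: contra_neq x0 => y0; rewrite def_x y0 mulr0.
by rewrite def_x exprSr; field; rewrite y0 P_neq0 expf_neq0.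
Qed.

Variable w : E.
Hypothesis wP : uniformizer O w.

Let mP : max_ideal O P.
Proof. by split=> //; right. Qed.

Let w_neq0 : w != 0.
Proof.
have /wP[y _] := mP.
by apply: contra_eq_neq => ->; rewrite mul0r.
Qed.

Let w_max : max_ideal O w.
Proof. by apply/wP; exists 1; rewrite ?mulr1 //; apply: subring1. Qed.

(** Some power of [w] is divisible by [p].  In a monic equation of [w] let [j] be
    the lowest index of a unit coefficient.  Modulo [p] the equation reads
    [w^j * g = 0] where [g] is a unit plus a multiple of [w]; as the nonunits
    are exactly the multiples of [w], [g] is a unit.  This is where the
    existence of a uniformizer replaces Hensel's lemma. *)
Let uniformizer_power : exists2 N, (0 < N)%N & exists2 y, O y & w ^+ N = P * y.
Proof.
have [[Q [mQ ZQ Qw]] _] := w_max.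
have exb : exists i, (Q`_i != 0) && ~~ val_ge v 1 Q`_i.
  exists (size Q).-1; rewrite -lead_coefE (monicP mQ) oner_neq0 /val_ge.
  by rewrite oner_eq0 (dval1 dvQ).
have [j /andP[Qj0 vQj] minQ] := ex_minnP exb.
have minj i : (i < j)%N -> val_ge v 1 Q`_i.
  apply: contraTT => nQi; rewrite -leqNgt; apply: minQ; rewrite nQi andbT.
  by apply: contra nQi => /eqP->; rewrite /val_ge eqxx.
have OQ i : O (h Q`_i) by apply/Oh/ZQ.
have Ow : O w by case: w_max.
have lowP : exists2 y, O y & (map_poly h (take_poly j Q)).[w] = P * y.
  have /choice[t tP] : forall i : 'I_j, exists t, Zp t /\ Q`_i = p%:R * t.
    by move=> i; have [t Zt ->] := val_geP (minj i (ltn_ord i)); exists t.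
  exists (\sum_(i < j) h (t i) * w ^+ i).
    apply: (subring_sum ringO) => i _; apply: (subringM ringO).
      by apply: Oh; case: (tP i).
    exact: (subringX ringO).
  rewrite (@horner_coef_wide _ j) ?size_map_poly ?size_take_poly // mulr_sumr.
  apply: eq_bigr => i _; rewrite coef_map coef_take_poly ltn_ord (tP i).2.
  by rewrite /= rmorphM rmorph_nat mulrA.
have defD : drop_poly j Q = (Q`_j)%:P + drop_poly j.+1 Q * 'X.
  apply/polyP=> -[|i]; rewrite coefD coefC coefMX !coef_drop_poly /= ?addr0 //.
  by rewrite add0r addSnnS.
have Oeval n : O (map_poly h (drop_poly n Q)).[w].
  rewrite horner_coef; apply: (subring_sum ringO) => i _.
  apply: (subringM ringO); last exact: (subringX ringO).
  by rewrite coef_map coef_drop_poly; apply: OQ.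
pose g := (map_poly h (drop_poly j Q)).[w].
have g_eq : g = h Q`_j + (map_poly h (drop_poly j.+1 Q)).[w] * w.
  by rewrite /g defD rmorphD rmorphM /= map_polyC map_polyX !hornerE.
have hQj0 : h Q`_j != 0 by rewrite fmorph_eq0.
have gV : g != 0 /\ O g^-1.
  apply: contrapT => nOg; have /wP[y Oy def_g] : max_ideal O g.
    split; first exact: Oeval.
    by have [->|g0] := eqVneq g 0; [left|right=> gV; apply: nOg].
  have [_ [/eqP|[]]] : max_ideal O (h Q`_j); rewrite ?(negPf hQj0) //.
    apply/wP; exists (y - (map_poly h (drop_poly j.+1 Q)).[w]).
      exact: (subringB ringO).
    by rewrite mulrBr -def_g g_eq [w * _]mulrC addrK.
  rewrite -fmorphV; apply/Oh/(dval_int dvQ); rewrite ?invr_eq0 //.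
  rewrite (dvalV dvQ) //; move: vQj (ZQ j); rewrite /val_ge (negPf Qj0) /=.
  by lia.
have [y Oy lowE] := lowP; exists j.+1 => //; exists (- y * g^-1 * w).
  by do 2?apply: (subringM ringO) => //; [apply: (subringN ringO)|case: gV].
move: Qw; rewrite /root -(poly_take_drop j Q) rmorphD rmorphM /= map_polyXn.
rewrite hornerD hornerM hornerXn -/g lowE addr_eq0 => /eqP Py.
have -> : P * (- y * g^-1 * w) = - (P * y) * g^-1 * w by ring.
by rewrite Py opprK [g * _]mulrC mulfK ?exprSr //; case: gV.
Qed.

Lemma padic_extension_valuation : exists vE, discrete_valuation O vE.
Proof.
apply: (valuation_of_uniformizer ringO wP w_neq0) => [x|x divx].
  have [s Os] := denominator x; exists (P ^+ s * x), (P ^+ s); split=> //.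
  - exact: (subringX ringO).
  - by rewrite expf_neq0.
  by rewrite mulrC mulKf ?expf_neq0.
have [N _ [t Ot wN]] := uniformizer_power.
apply: padic_separated => n; have [y Oy ->] := divx (N * n)%N.
exists (t ^+ n * y); first exact: (subringM ringO (subringX ringO _ Ot)).
by rewrite exprM wN exprMn mulrA.
Qed.

(** Raising to the power given by [uniformizer_power] and homogenising the
    monic equation of the cofactor gives an equation of Eisenstein type. *)
Let eisenstein_equation z : max_ideal O z ->
  exists2 n, (0 < n)%N & exists W : {poly Qp},
    [/\ forall i, Zp W`_i, (size W <= n)%N & z ^+ n = P * (map_poly h W).[z]].
Proof.
move=> /wP[y Oy def_z]; have [N N0 [t Ot wN]] := uniformizer_power.
have [Q [mQ ZQ]] : O (t * y ^+ N) by apply: (subringM ringO) => //; apply: (subringX ringO).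
have zN : z ^+ N = P * (t * y ^+ N) by rewrite def_z exprMn wN mulrA.
move: (t * _) zN => u zN; rewrite /root horner_coef size_map_poly.
have szQ : (0 < size Q)%N by rewrite size_poly_gt0 monic_neq0.
case defe: (size Q) szQ => [//|e] _; rewrite big_ord_recr /= coef_map /=.
have -> : Q`_e = 1 by rewrite -(monicP mQ) lead_coefE defe.
rewrite rmorph1 mul1r addrC addr_eq0 => /eqP uE.
case: e defe uE => [|e] defe uE.
  by move/eqP: uE; rewrite big_ord0 oppr0 expr0 oner_eq0.
exists (N * e.+1)%N; first by rewrite muln_gt0 N0.
exists (- \sum_(i < e.+1) (Q`_i * p%:R ^+ (e - i)) *: 'X^(N * i)); split.
- move=> k; rewrite coefN; apply: (subringN ringZ); rewrite coef_sum.
  apply: (subring_sum ringZ) => i _; rewrite coefZ coefXn.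
  apply: (subringM ringZ); last exact: (subring_nat ringZ).
  by apply: (subringM ringZ) => //; apply/(subringX ringZ)/(subring_nat ringZ).
- rewrite size_polyN; apply: leq_trans (size_sum _ _ _) _.
  apply/bigmax_leqP => i _; apply: leq_trans (size_scale_leq _ _) _.
  by rewrite size_polyXn ltn_mul2l N0 ltn_ord.
rewrite exprM zN exprMn uE exprS -mulrA; congr (_ * _).
rewrite rmorphN hornerN mulrN; congr (- _).
rewrite raddf_sum horner_sum mulr_sumr; apply: eq_bigr => i _ /=.
rewrite map_polyZ map_polyXn hornerZ hornerXn exprM zN exprMn.
rewrite coef_map rmorphM rmorphXn rmorph_nat -/P.
have -> : P ^+ e = P ^+ (e - i) * P ^+ i by rewrite -exprD subnK // -ltnS.
by ring.
Qed.

(** An equation of Eisenstein type makes [z^n] divisible by [p] inside [Zp[z]]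
    itself, which is a quotient of [Zp^n]; so series in [z] converge as soon as
    their [n] coordinates do. *)
Section Division.
Variables (n : nat) (W : {poly Qp}) (z : E).
Hypotheses (n_gt0 : (0 < n)%N) (ZW : forall i, Zp W`_i) (szW : (size W <= n)%N).
Hypothesis zn : z ^+ n = P * (map_poly h W).[z].

Let reduce (G : {poly Qp}) : (forall i, Zp G`_i) ->
  exists B : {poly Qp}, [/\ forall i, Zp B`_i, (size B <= n)%N
    & (map_poly h B).[z] = (map_poly h G).[z]].
Proof.
elim/poly_ind: G => [|G c IHG] ZG.
  by exists 0; split; rewrite ?size_poly0.
have [i|B [ZB szB BG]] := IHG.
  by have := ZG i.+1; rewrite coefD coefMX coefC addr0.
have Zc : Zp c by have := ZG 0%N; rewrite coefD coefMX coefC add0r.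
pose b := B`_n.-1; have Zb : Zp b by apply: ZB.
exists (B * 'X + c%:P - b *: 'X^n + (b * p%:R) *: W); split.
- move=> i; rewrite !coefD coefN !coefZ coefC coefMX coefXn.
  apply: (subringD ringZ); last first.
    apply: (subringM ringZ) (ZW i).
    by apply: (subringM ringZ) => //; apply: (subring_nat ringZ).
  apply: (subringB ringZ); last first.
    by apply: (subringM ringZ) => //; apply: (subring_nat ringZ).
  by apply: (subringD ringZ); case: ifP => // _; exact: (subring0 ringZ).
- apply/leq_sizeP => i le_ni; rewrite !coefD coefN !coefZ coefC coefMX coefXn.
  rewrite (leq_sizeP _ _ szW i le_ni) mulr0 addr0.
  have -> : (i == 0)%N = false by lia.
  rewrite addr0; have [->|ne_in] := eqVneq i n; first by rewrite mulr1 subrr.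
  by rewrite mulr0 subr0 (leq_sizeP _ _ szB) //; lia.
rewrite !(rmorphD, rmorphN, rmorphM) /= !map_polyZ map_polyXn map_polyX !map_polyC.
by rewrite !hornerE zn BG rmorphM rmorph_nat -/P; ring.
Qed.

Lemma divided_powers : exists B : nat -> {poly Qp}, forall k,
  [/\ forall i, Zp (B k)`_i, (size (B k) <= n)%N
    & z ^+ k = P ^+ (k %/ n) * (map_poly h (B k)).[z]].
Proof.
suff /choice[B BP] : forall k, exists B : {poly Qp}, [/\ forall i, Zp B`_i,
    (size B <= n)%N & z ^+ k = P ^+ (k %/ n) * (map_poly h B).[z]].
  by exists B.
move=> k.
have [|B [ZB szB BE]] := @reduce (W ^+ (k %/ n) * 'X^(k %% n)).
  move=> i; rewrite coefMXn; case: ifP => _; first exact: (subring0 ringZ).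
  move: (i - _)%N => {}i; elim: (k %/ n)%N i => [|q IHq] i.
    by rewrite expr0 coef1; apply: (subring_nat ringZ).
  rewrite exprS coefM; apply: (subring_sum ringZ) => l _.
  exact: (subringM ringZ).
exists B; split=> //.
rewrite BE rmorphM rmorphXn /= map_polyXn hornerM horner_exp hornerXn mulrA.
by rewrite -exprMn -zn -exprM -exprD mulnC -divn_eq.
Qed.

Lemma padic_series_cv (c : nat -> Qp) : O z -> (forall k, Zp (c k)) ->
  exists2 l, O l & forall j, exists N, forall K, (N <= K)%N ->
    exists2 y, O y & l - \sum_(k < K) h (c k) * z ^+ k = P ^+ j * y.
Proof.
move=> Oz Zc; have [B BP] := divided_powers.
pose S i K := \sum_(k < K) c k * p%:R ^+ (k %/ n) * (B k)`_i.
have ZS i K : Zp (S i K).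
  apply: (subring_sum ringZ) => k _; apply: (subringM ringZ); last by case: (BP k).
  by apply: (subringM ringZ) => //; apply/(subringX ringZ)/(subring_nat ringZ).
have geM a b N : 0 <= N -> val_ge v N a -> Zp b -> val_ge v N (a * b).
  move=> N0; have [->|a0] := eqVneq a 0; first by rewrite mul0r /val_ge eqxx.
  have [->|b0] := eqVneq b 0; first by rewrite mulr0 /val_ge eqxx.
  by rewrite /val_ge mulf_eq0 (negPf a0) (negPf b0) /= (dvalM dvQ) //; lia.
have tail i K K' (N : nat) : (N * n <= K <= K')%N -> val_ge v N%:Z (S i K' - S i K).
  case/andP=> leN; elim: K' => [|K' IHK'].
    by rewrite leqn0 => /eqP->; rewrite subrr /val_ge eqxx.
  rewrite leq_eqVlt => /predU1P[<-|ltK]; first by rewrite subrr /val_ge eqxx.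
  rewrite /S big_ord_recr /= addrAC; apply: (Qp_valD QpP); first exact: IHK'.
  rewrite -mulrA mulrC -mulrA; apply: geM => //; last first.
    by apply: (subringM ringZ) => //; case: (BP K').
  rewrite /val_ge (negPf (expf_neq0 _ p_neq0)) (dvalXn dvQ) //.
  by rewrite padic_val_p mulr1 lez_nat leq_divRL //=; lia.
have val_geN N (x y : Qp) : val_ge v N (x - y) -> val_ge v N (y - x).
  rewrite /val_ge -[y - x]opprB oppr_eq0.
  by have [//|xy0] := eqVneq (x - y) 0; rewrite (dvalN dvQ).
have /choice[l lP] : forall i, exists li, forall N : int, exists n0 : nat,
    forall K, (n0 <= K)%N -> val_ge v N (S i K - li).
  move=> i; apply: (Qp_complete QpP) => N; exists (`|N| * n)%N => K K' leK leK'.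
  have le_val M x : val_ge v `|M|%N%:Z x -> val_ge v M x.
    by rewrite /val_ge; case: eqP => //= _; lia.
  apply: le_val; have [leKK|/ltnW leKK] := leqP K K'.
    by apply/val_geN/tail; rewrite leK.
  by apply: tail; rewrite leK'.
have Zl i : Zp (l i).
  have [n0 /(_ n0 (leqnn _))/val_geN l0] := lP i 0.
  by rewrite -(subrK (S i n0) (l i)); apply: (subringD ringZ).
exists (\sum_(i < n) h (l i) * z ^+ i).
  apply: (subring_sum ringO) => i _; apply: (subringM ringO); first exact: Oh.
  exact: (subringX ringO).
move=> j; have /choice[N NP] : forall i : 'I_n, exists n0 : nat, forall K,
    (n0 <= K)%N -> exists2 y, Zp y & l i - S i K = p%:R ^+ j * y.
  move=> i; have [n0 n0P] := lP i j; exists n0 => K leK.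
  exact/val_geP/val_geN/n0P.
exists (\max_(i < n) N i)%N => K leK.
have /choice[y yP] : forall i : 'I_n, exists y, Zp y /\ l i - S i K = p%:R ^+ j * y.
  move=> i; have [|y Zy yE] := NP i K; last by exists y.
  by apply: leq_trans leK; apply: leq_bigmax.
exists (\sum_(i < n) h (y i) * z ^+ i).
  apply: (subring_sum ringO) => i _; apply: (subringM ringO).
    by apply: Oh; case: (yP i).
  exact: (subringX ringO).
have -> : \sum_(k < K) h (c k) * z ^+ k = \sum_(i < n) h (S i K) * z ^+ i.
  rewrite (eq_bigr (fun k : 'I_K => \sum_(i < n)
      h (c k * p%:R ^+ (k %/ n) * (B k)`_i) * z ^+ i)); last first.
    move=> k _; have [_ szB ->] := BP k.
    rewrite (@horner_coef_wide _ n) ?size_map_poly // mulrA mulr_sumr.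
    apply: eq_bigr => i _; rewrite coef_map !rmorphM rmorphXn rmorph_nat -/P.
    by rewrite mulrA.
  rewrite exchange_big; apply: eq_bigr => i _.
  by rewrite -mulr_suml /S rmorph_sum.
rewrite -sumrB mulr_sumr; apply: eq_bigr => i _.
by rewrite -mulrBl -rmorphB (yP i).2 rmorphM rmorphXn rmorph_nat mulrA.
Qed.

End Division.

Lemma padic_root_one_plus m z :
    (0 < m)%N -> O m%:R^-1 -> m%:R != 0 :> E -> max_ideal O z ->
  exists l, l ^+ m = 1 + z.
Proof.
move=> m0 Om m_neq0 mz; have [Oz _] := mz.
have [n n0 [W [ZW szW zn]]] := eisenstein_equation mz.
apply: (@root_of_one_plus E (fun x => exists2 a, Zp a & x = h a) O
          (fun n x => exists2 y, O y & x = P ^+ n * y)) => //.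
- split; first by exists 1; [apply: (subring1 ringZ)|rewrite rmorph1].
    move=> _ _ [a Za ->] [b Zb ->]; exists (a - b); last by rewrite rmorphB.
    exact: (subringB ringZ).
  move=> _ _ [a Za ->] [b Zb ->]; exists (a * b); last by rewrite rmorphM.
  exact: (subringM ringZ).
- by move=> _ [a Za ->]; apply: Oh.
- exists m%:R^-1; last by rewrite fmorphV rmorph_nat.
  apply/(dval_integrally_closed dvQ (f := h)).
  by rewrite fmorphV rmorph_nat.
- move=> j x y [a Oa ->] [b Ob ->]; exists (a - b); last by rewrite mulrBr.
  exact: (subringB ringO).
- move=> j x y Ox [a Oa ->]; exists (x * a); last by ring.
  exact: (subringM ringO).
- move=> j; have [B BP] := divided_powers n0 ZW szW zn.
  exists (j * n)%N => K leK; have [ZB _ ->] := BP K.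
  exists (P ^+ (K %/ n - j) * (map_poly h (B K)).[z]).
    apply: (subringM ringO); first exact: (subringX ringO).
    rewrite horner_coef; apply: (subring_sum ringO) => i _.
    apply: (subringM ringO); last exact: (subringX ringO).
    by rewrite coef_map; apply: Oh.
  by rewrite mulrA -exprD subnKC // leq_divRL.
move=> c Cc; have /choice[c' cP] : forall k, exists a, Zp a /\ c k = h a.
  by move=> k; have [a] := Cc k; exists a.
have [|k|l Ol lP] := @padic_series_cv n W z n0 ZW szW zn c' => //.
  by case: (cP k).
exists l => // j; have [N NP] := lP j; exists N => K /NP[y Oy yE]; exists y => //.
rewrite -yE; congr (_ - _); apply: eq_bigr => k _.
by rewrite (cP k).2.
Qed.

End Padic.

(** * Residue fields and local fields *)

Section ResidueField.
Variables (F : fieldType) (O : F -> Prop) (k : finFieldType) (res : F -> k).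
Hypotheses (ringO : subring O) (hres : is_residue_field O res).

Lemma residue0 : res 0 = 0.
Proof.
have O0 := subring0 ringO; have /eqP := resD hres O0 O0.
by rewrite addr0 -subr_eq subrr eq_sym => /eqP.
Qed.

Lemma residue_nat n : res n%:R = n%:R.
Proof.
elim: n => [|n IHn]; first exact: residue0.
have [On O1] := (subring_nat ringO n, subring1 ringO).
by rewrite -!natr1 (resD hres) // (res1 hres) IHn.
Qed.

Definition residue_morph of is_residue_field O res :
  subring_type ringO -> k := res \o val.

Fact residue_nmod_morphism : nmod_morphism (residue_morph hres).
Proof.
split=> [|x y]; rewrite /residue_morph /=; first exact: residue0.
by rewrite (resD hres) //; apply: subring_val.
Qed.

Fact residue_monoid_morphism : monoid_morphism (residue_morph hres).
Proof.
split=> [|x y]; rewrite /residue_morph /=; first exact: (res1 hres).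
by rewrite (resM hres) //; apply: subring_val.
Qed.

HB.instance Definition _ :=
  GRing.isNmodMorphism.Build _ _ (residue_morph hres) residue_nmod_morphism.
HB.instance Definition _ :=
  GRing.isMonoidMorphism.Build _ _ (residue_morph hres) residue_monoid_morphism.

Lemma residue_lift_poly (u : {poly k}) :
  exists U : {poly subring_type ringO}, map_poly (residue_morph hres) U = u.
Proof.
have /choice[s sP] : forall z : k, exists x : subring_type ringO,
    residue_morph hres x = z.
  move=> z; have [x Ox <-] := res_surj hres z.
  by exists (exist _ x (asboolT Ox)).
exists (\poly_(i < size u) s u`_i); apply/polyP=> i.
rewrite coef_map coef_poly; case: ltnP => [_|le_i] /=; first exact: sP.
by rewrite rmorph0 nth_default.
Qed.

Lemma residue_unit x : O x -> res x != 0 -> x != 0 /\ O x^-1.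
Proof.
move=> Ox rx0.
have nmx : ~ max_ideal O x by move/(res_ker hres Ox)/eqP; rewrite (negPf rx0).
split; first by apply: contra_notN nmx => /eqP->; split; [apply: subring0|left].
by apply: contrapT => nOx; apply: nmx; split; [|right].
Qed.

End ResidueField.

(** The only facts on local fields that the norm computation uses: both kinds of
    local fields are discretely valued, and their principal units are [m]-th
    powers when [m] is prime to the residual characteristic. *)
Lemma local_field_structure (F : fieldType) (O : F -> Prop) (w : F)
    (k : finFieldType) (res : F -> k) (m : nat) :
    local_field O -> uniformizer O w -> is_residue_field O res ->
    (0 < m)%N -> m%:R != 0 :> k ->
  (exists v, discrete_valuation O v) /\
  (forall z, max_ideal O z -> exists l, l ^+ m = 1 + z).
Proof.
move=> lF wP hres m0 km0.
have m_unit : subring O -> m%:R != 0 :> F /\ O m%:R^-1.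
  move=> ringO; apply: (residue_unit ringO hres); first exact: subring_nat.
  by rewrite (residue_nat ringO hres).
case: lF => [p Qp iota v L f QpP [g fK gK] OE | K coef lF OE].
  pose h : {rmorphism Qp -> F} := f \o in_alg L.
  have defO : O = integral_closure h (val_ge v 0).
    apply/funext=> y; apply/propext; rewrite -(gK y) OE.
    have rootE (P : {poly Qp}) : root (map_poly h P) (f (g y)) =
        root (map_poly (in_alg L) P) (g y).
      by rewrite -(fmorph_root f) -map_poly_comp.
    by split=> -[P [mP ZP Px]]; exists P; split=> //; rewrite ?rootE // -rootE.
  have alg_h y : algebraicOver h y.
    have /polyOver1P[P PE] := minPolyOver 1 (g y); exists P.
      by rewrite -(map_poly_eq0 (in_alg L)) -PE monic_neq0 ?monic_minPoly.
    rewrite -(gK y) [map_poly _ _](map_poly_comp f (in_alg L)) fmorph_root -PE.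
    exact: root_minPoly.
  rewrite defO in wP m_unit hres *.
  have [vE dv] := padic_extension_valuation QpP alg_h wP.
  have [m_neq0 Om] := m_unit (dval_ring dv).
  by split=> [|z]; [exists vE|apply: (padic_root_one_plus QpP alg_h wP)].
have defO : O = fun x => vanishes_below 0 (coef x).
  by apply/funext=> x; apply/propext; apply: OE.
rewrite defO in wP m_unit hres *.
have [vE dv _] := laurent_valuation lF.
have [m_neq0 Om] := m_unit (dval_ring dv).
by split=> [|z]; [exists vE|apply: (laurent_root_one_plus lF)].
Qed.

(** * Power residues in a finite field *)

Section FiniteField.
Variables (k : finFieldType) (n m : nat).
Hypotheses (card_k : #|k| = n.+1) (m_dvd : (m %| n)%N).

Local Notation r := (n %/ m)%N.

Let n_gt0 : (0 < n)%N.
Proof. by have := finNzRing_gt1 k; rewrite card_k. Qed.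

Let m_gt0 : (0 < m)%N := dvdn_gt0 n_gt0 m_dvd.

Lemma finField_pow_pred (a : k) : a != 0 -> a ^+ n = 1.
Proof.
by move=> a0; apply: (mulfI a0); rewrite -exprS -card_k expf_card mulr1.
Qed.

Lemma finField_primitive : exists g : k, n.-primitive_root g.
Proof.
pose rs := [seq x <- enum k | x != 0].
have /hasP[g _ gP] : has n.-primitive_root rs.
  apply: has_prim_root => //.
  - apply/allP=> x; rewrite mem_filter => /andP[x0 _].
    by rewrite unity_rootE finField_pow_pred.
  - exact/filter_uniq/enum_uniq.
  rewrite size_filter -ltnS -card_k cardE -(count_predC (pred1 (0 : k))).
  by rewrite -add1n leq_add2r (count_uniq_mem _ (enum_uniq _)) leq_b1.
by exists g.
Qed.

Lemma finField_residue_is_power (a : k) : a != 0 -> a ^+ r = 1 -> exists z, z ^+ m = a.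
Proof.
move=> a0; have [g gP] := finField_primitive.
have r0 : (0 < r)%N by rewrite divn_gt0 // dvdn_leq.
have [i ->] := prim_rootP gP (finField_pow_pred a0).
rewrite -exprM => /eqP; rewrite -(prim_order_dvd gP).
rewrite -{1}(divnK m_dvd) mulnC dvdn_pmul2r //.
by case/dvdnP=> t ->; exists (g ^+ t); rewrite -exprM.
Qed.

Lemma finField_power_residue (a : k) : a != 0 -> (a ^+ m) ^+ r = 1.
Proof. by move=> a0; rewrite -exprM mulnC divnK // finField_pow_pred. Qed.

(** A common root of [g] and [X^m - b] in an extension is moved by the Frobenius
    through all [m] roots of [X^m - b], too many for the degree of [g].  In
    other words [X^m - b] is irreducible. *)
Lemma coprimep_Xn_sub_nonpower (b : k) (g : {poly k}) :
    m.-primitive_root (b ^+ r) -> g != 0 -> (size g <= m)%N ->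
  coprimep g ('X^m - b%:P).
Proof.
move=> chiP g0 szg; apply: contraT => ncop.
have m0 := prim_order_gt0 chiP.
pose D := gcdp g ('X^m - b%:P).
have D0 : D != 0 by rewrite gcdp_eq0 negb_and g0.
have [L [rs Drs _]] := FinSplittingFieldFor D0.
pose iA : {rmorphism k -> L} := in_alg L.
have [gam gamP] : exists gam : L, root (map_poly iA D) gam.
  case: rs Drs => [|z rs] Drs; last first.
    by exists z; rewrite (eqp_root Drs) root_prod_XsubC mem_head.
  move: Drs; rewrite big_nil -size_poly_eq1 size_map_poly -/D => szD.
  by rewrite /coprimep szD in ncop.
have rootD p : D %| p -> root (map_poly iA p) gam.
  rewrite -(dvdp_map iA) -dvdp_XsubCl => /(dvdp_trans _); apply.
  by rewrite dvdp_XsubCl.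
have rootg : root (map_poly iA g) gam.
  by apply: rootD; apply: dvdp_gcdl.
have gam_m : gam ^+ m = iA b.
  have : root (map_poly iA ('X^m - b%:P)) gam.
    by apply: rootD; apply: dvdp_gcdr.
  rewrite rmorphB /= map_polyXn map_polyC /root !hornerE subr_eq0.
  by move/eqP.
have [alpha _ alphaP] := finField_galois_generator (subvf (1%AS : {subfield L})).
have alphaE x : alpha x = x ^+ #|k|.
  by rewrite alphaP ?memvf // dimv1 expn1.
have frob x : root (map_poly iA g) x -> root (map_poly iA g) (x ^+ #|k|).
  rewrite /root -!alphaE => /eqP gx.
  have -> : map_poly iA g = map_poly alpha (map_poly iA g).
    by apply/polyP=> i; rewrite !coef_map /= linearZ /= rmorph1.
  by rewrite horner_map /= gx rmorph0.
pose chi := b ^+ r.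
have roots i : root (map_poly iA g) (iA (chi ^+ i) * gam).
  elim: i => [|i /frob]; first by rewrite expr0 rmorph1 mul1r.
  rewrite exprMn -rmorphXn expf_card card_k.
  rewrite exprSr -{1}(divnK m_dvd) mulnC exprM gam_m -rmorphXn -/chi mulrA.
  by rewrite -rmorphM -exprSr.
have b0 : b != 0.
  apply: contra_eq_neq (prim_expr_order chiP) => ->.
  rewrite -exprM divnK // expr0n eqn0Ngt n_gt0.
  by rewrite eq_sym oner_neq0.
have gam0 : gam != 0.
  apply: contra_neq b0 => gam0; apply/eqP.
  by rewrite -(fmorph_eq0 iA) -gam_m gam0 expr0n eqn0Ngt m0.
have := @max_poly_roots _ (map_poly iA g)
  [seq iA (chi ^+ i) * gam | i <- iota 0 m].
rewrite map_poly_eq0 size_map_poly size_map size_iota ltnNge szg; apply=> //.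
  by apply/allP=> _ /mapP[i _ ->].
rewrite map_inj_in_uniq ?iota_uniq // => i j; rewrite !mem_iota /= => lti ltj.
move/(mulIf gam0)/(fmorph_inj iA)/eqP; rewrite (eq_prim_root_expr chiP).
by rewrite !modn_small // => /eqP.
Qed.

End FiniteField.

(** * Norms in a Kummer extension *)

Section ScalarEmbedding.
Variables (F : fieldType) (K : splittingFieldType F).

Lemma algX (a : F) n : (a ^+ n)%:A = a%:A ^+ n :> K.
Proof. exact: (rmorphXn (in_alg K)). Qed.

Lemma algV (a : F) : (a^-1)%:A = a%:A^-1 :> K.
Proof. exact: (fmorphV (in_alg K)). Qed.

Lemma algM (a b : F) : (a * b)%:A = a%:A * b%:A :> K.
Proof. exact: (rmorphM (in_alg K)). Qed.

Lemma algXz (a : F) (n : int) : (a ^ n)%:A = a%:A ^ n :> K.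
Proof.
case: n => n; first exact: algX.
by rewrite !NegzE -!invr_expz algV [in LHS]algX.
Qed.

Lemma alg_eq0 (a : F) : (a%:A == 0 :> K) = (a == 0).
Proof. exact: (fmorph_eq0 (in_alg K)). Qed.

Lemma alg_inj (a b : F) : a%:A = b%:A :> K -> a = b.
Proof. exact: (fmorph_inj (in_alg K)). Qed.

End ScalarEmbedding.

Section TameExtension.
Variables (F : fieldType) (O : F -> Prop) (v : F -> int).
Hypothesis dv : discrete_valuation O v.
Variables (m : nat) (zeta : F) (K : splittingFieldType F).
Hypotheses (zetaP : m.-primitive_root zeta) (m_odd : odd m).
Hypotheses (hgal : galois 1 {:K}) (hdeg : \dim {:K} = m).

Local Notation OK := (integral_closure (in_alg K) O).
Local Notation G := ('Gal({:K} / 1))%g.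
Local Notation norm := (galNorm 1 {:K}).

Let ringO : subring O := dval_ring dv.
Let ringOK : subring OK := integral_closure_subring ringO (in_alg K).
Let m_gt0 : (0 < m)%N := prim_order_gt0 zetaP.

Lemma card_gal : #|G| = m.
Proof. by have /galois_dim := hgal; rewrite dimv1 divn1 hdeg. Qed.

Lemma gal_alg (s : gal_of {:K}) (a : F) : s a%:A = a%:A.
Proof. by rewrite linearZ /= rmorph1. Qed.

Lemma norm_alg (a : F) : norm a%:A = (a ^+ m)%:A.
Proof.
rewrite /galNorm (eq_bigr (fun=> a%:A)) => [|s _]; last exact: gal_alg.
by rewrite prodr_const card_gal -algX.
Qed.

Lemma norm_base y : exists a : F, norm y = a%:A.
Proof. by have /vlineP[a ->] := mem_galNorm hgal (memvf y); exists a. Qed.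

Lemma OK_alg (a : F) : O a -> OK a%:A.
Proof. exact: (integral_closure_id ringO (in_alg K)). Qed.

Lemma OK_base (a : F) : OK a%:A -> O a.
Proof. exact: (dval_integrally_closed dv (f := in_alg K)). Qed.

Lemma OK_root y (a : F) : O a -> y ^+ m = a%:A -> OK y.
Proof. exact: (integral_closure_root ringO (f := in_alg K)). Qed.

Lemma OK_gal (s : gal_of {:K}) y : OK y -> OK (s y).
Proof.
move=> [P [mP OP /eqP Py]]; exists P; split=> //.
have -> : map_poly (in_alg K) P = map_poly s (map_poly (in_alg K) P).
  by apply/polyP=> i; rewrite !coef_map /= gal_alg.
by rewrite /root horner_map /= Py rmorph0.
Qed.

Lemma OK_norm y a : OK y -> norm y = a%:A -> O a.
Proof.
move=> Oy Na; apply: OK_base; rewrite -Na.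
by apply: (subring_prod ringOK) => s _; apply: OK_gal.
Qed.

Lemma root_of_unity_base (z : K) : z ^+ m = 1 -> exists2 o : F, o ^+ m = 1 & z = o%:A.
Proof.
have zetaK : m.-primitive_root (zeta%:A : K).
  by rewrite -[_%:A]/(in_alg K zeta) fmorph_primitive_root.
case/(prim_rootP zetaK)=> i ->; exists (zeta ^+ i).
  by rewrite exprAC (prim_expr_order zetaP) expr1n.
by rewrite algX.
Qed.

Lemma gal_root (alpha : K) (b : F) (s : gal_of {:K}) :
    alpha != 0 -> alpha ^+ m = b%:A ->
  exists2 o : F, o ^+ m = 1 & s alpha = o%:A * alpha.
Proof.
move=> a0 ab; have [|o o1 oE] := @root_of_unity_base (s alpha / alpha).
  by rewrite exprMn exprVn -rmorphXn ab /= gal_alg -ab mulfV ?expf_neq0.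
by exists o => //; rewrite -oE divfK.
Qed.

(** The product of the root of unity [s alpha / alpha] over all [s] is its own
    inverse, and it is an [m]-th root of unity with [m] odd. *)
Lemma norm_root (alpha : K) (b : F) :
  alpha != 0 -> alpha ^+ m = b%:A -> norm alpha = b%:A.
Proof.
move=> a0 ab; pose u := \prod_(s in G) (s alpha / alpha).
have -> : norm alpha = u * b%:A.
  rewrite /u big_split /= prodr_const card_gal exprVn ab.
  by rewrite divfK // -ab expf_neq0.
have um : u ^+ m = 1.
  rewrite -prodrXl big1 // => s _; have [o o1 ->] := gal_root s a0 ab.
  by rewrite mulfK // -algX o1 scale1r.
have uV : u = u^-1.
  rewrite -prodfV {1}/u (reindex_inj invg_inj) /=.
  apply: eq_big => [s|s _]; first by rewrite groupV.
  have [o o1 sE] := gal_root s a0 ab.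
  have sVE : alpha = o%:A * (s^-1)%g alpha.
    rewrite -{1}[alpha](gal_id {:K}) -(mulgV s) galM ?memvf // sE.
    by rewrite rmorphM /= gal_alg.
  have sV0 : (s^-1)%g alpha != 0 by rewrite fmorph_eq0.
  rewrite sE mulfK // [X in _ / X]sVE.
  by rewrite invfM mulrCA mulfV // mulr1.
have u0 : u != 0.
  by apply: contra_eq_neq um => ->; rewrite expr0n eqn0Ngt m_gt0 eq_sym oner_neq0.
have uu : u * u = 1 by rewrite {2}uV mulfV.
move: um; rewrite -[m]odd_double_half m_odd add1n exprS -mul2n exprM expr2 uu.
by rewrite expr1n mulr1 => ->; rewrite mul1r.
Qed.

(** [theta] stands for a uniformizer of [F] if [K] is unramified, and for an
    [m]-th root of a uniformizer of [F] if [K] is ramified.  In both cases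
    [theta^m] lies in [F], so that the ideal generated by [theta] is stable
    under the Galois group and meets [F] in the maximal ideal. *)
Section PrincipalUnits.
Variables (theta : K) (d : F).
Hypotheses (theta_neq0 : theta != 0) (thetaE : theta ^+ m = d%:A).
Hypothesis d_max : max_ideal O d.

Let Otheta : OK theta.
Proof. by apply: OK_root thetaE; case: d_max. Qed.

Let principal y := exists2 r, OK r & y = 1 + theta * r.

Let principalM x y : principal x -> principal y -> principal (x * y).
Proof.
move=> [r Or ->] [s Os ->]; exists (r + s + theta * r * s); last by ring.
apply: (subringD ringOK); first exact: (subringD ringOK).
by do 2?apply: (subringM ringOK).
Qed.

Let gal_principal (s : gal_of {:K}) y : principal y -> principal (s y).
Proof.
move=> [r Or ->]; have [o o1 sE] := gal_root s theta_neq0 thetaE.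
exists (o%:A * s r); last by rewrite rmorphD rmorphM rmorph1 /= sE; ring.
apply: (subringM ringOK); last exact: OK_gal.
by apply/OK_alg/(dval_int_root dv m_gt0); rewrite o1; apply: subring1.
Qed.

Let principal_OK y : principal y -> OK y.
Proof.
by move=> [r Or ->]; apply: (subringD ringOK (subring1 ringOK)); apply: (subringM ringOK).
Qed.

Lemma principal_unit_base (a : F) r : OK r -> a%:A = 1 + theta * r -> max_ideal O (a - 1).
Proof.
move=> Or aE; have zE : (a - 1)%:A = theta * r.
  by rewrite scalerBl scale1r aE addrC addKr.
have Oz : O (a - 1) by apply: OK_base; rewrite zE; apply: (subringM ringOK).
apply: (dval_max_idealX dv (n := m)) => //.
have [d0|d_neq0] := eqVneq d 0.
  by have := expf_neq0 m theta_neq0; rewrite thetaE d0 scale0r eqxx.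
rewrite -[_ ^+ m](divfK d_neq0); apply: (dval_max_idealM dv) => //.
apply: OK_base; have -> : ((a - 1) ^+ m / d)%:A = r ^+ m.
  rewrite algM algX algV zE exprMn thetaE.
  by rewrite mulrC mulKf // alg_eq0.
exact: (subringX ringOK).
Qed.

Lemma norm_principal_unit r : OK r ->
  exists2 z, max_ideal O z & norm (1 + theta * r) = (1 + z)%:A.
Proof.
move=> Or; have [a Na] := norm_base (1 + theta * r).
have [s Os sE] : principal (norm (1 + theta * r)).
  rewrite /galNorm; elim/big_ind: _ => [||s _]; last by apply: gal_principal; exists r.
    by exists 0; [apply: (subring0 ringOK)|rewrite mulr0 addr0].
  exact: principalM.
exists (a - 1); last by rewrite Na addrC subrK.
by apply: (principal_unit_base Os); rewrite -sE.
Qed.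

(** The inverse is the product of the other conjugates divided by the norm. *)
Lemma principal_unit_inv r : OK r -> 1 + theta * r != 0 /\ OK (1 + theta * r)^-1.
Proof.
move=> Or; have [z zm Nz] := norm_principal_unit Or.
have [z1 Oz1 Oz1V] := dval_one_plus dv zm.
have u0 : 1 + theta * r != 0.
  by rewrite -(galNorm_eq0 1 {:K}) Nz alg_eq0.
split=> //.
move: Nz; rewrite /galNorm (bigD1 1%g) ?group1 //= gal_id.
set t := \prod_(s in _ | _) _ => Nz.
have -> : (1 + theta * r)^-1 = t * (1 + z)^-1%:A.
  rewrite algV -Nz invfM mulrCA mulfV ?mulr1 //.
  by apply: contraNneq z1 => t0; move/eqP: Nz; rewrite t0 mulr0 eq_sym alg_eq0.
apply: (subringM ringOK); last exact: OK_alg.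
apply: (subring_prod ringOK) => s _; apply: principal_OK; apply: gal_principal.
by exists r.
Qed.

End PrincipalUnits.

Lemma adjoin_root_span (alpha : K) : prime m -> alpha \notin 1%VS -> forall x,
  exists2 P : {poly F}, (size P <= m)%N & x = (map_poly (in_alg K) P).[alpha].
Proof.
move=> m_pr na x.
have dimA : \dim <<1; alpha>> = m.
  have /field_dimS := subvf <<1; alpha>>%AS.
  rewrite hdeg => /(primeP m_pr).2 /pred2P[] // dim1.
  case/negP: na; rewrite (sameP Fadjoin_idP eqP) eq_sym eqEdim subv_adjoin.
  by rewrite dim1 dimv1.
have fullA : <<1; alpha>>%VS = {:K}%VS.
  by apply/eqP; rewrite eqEdim subvf hdeg dimA leqnn.
have x_in : x \in <<1; alpha>>%VS by rewrite fullA memvf.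
have /polyOver1P[P PE] := Fadjoin_polyOver 1 alpha x.
exists P; last by rewrite -PE Fadjoin_poly_eq.
rewrite -(size_map_poly (in_alg K)) -PE (leq_trans (size_Fadjoin_poly _ _ _)) //.
by rewrite adjoin_degreeE dimA dimv1 divn1.
Qed.


(** * Adjoining an m-th root of a unit *)

Section UnramifiedCase.
Variables (k : finFieldType) (res : F -> k) (n : nat).
Hypotheses (hres : is_residue_field O res) (card_k : #|k| = n.+1).
Hypotheses (m_dvd : (m %| n)%N) (m_pr : prime m).
Variables (alpha : K) (b w : F).
Hypotheses (alpha_nbase : alpha \notin 1%VS) (alphaE : alpha ^+ m = b%:A).
Hypotheses (Ob : O b) (chiP : m.-primitive_root (res b ^+ (n %/ m))).
Hypothesis wP : uniformizer O w.

Local Notation R := (subring_type ringO).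
Local Notation rho := (residue_morph hres : {rmorphism R -> k}).

Let w_neq0 : w != 0. Proof. by case/(dval_uniformizer dv): wP. Qed.
Let vw : v w = 1. Proof. by case/(dval_uniformizer dv): wP. Qed.
Let w_max : max_ideal O w.
Proof. by apply/(dval_max_ideal dv); rewrite ?vw. Qed.
Let Ow : O w. Proof. by case: w_max. Qed.

Let e : {rmorphism R -> K} := in_alg K \o val.

Let eval (T : {poly R}) : K := (map_poly e T).[alpha].

Let evalE T : eval T = (map_poly (in_alg K) (map_poly val T)).[alpha].
Proof. by rewrite -map_poly_comp. Qed.

Let OK_coef_eval (P : {poly F}) :
  (forall i, O P`_i) -> OK (map_poly (in_alg K) P).[alpha].
Proof.
move=> OP; rewrite horner_coef; apply: (subring_sum ringOK) => i _.
apply: (subringM ringOK); first by rewrite coef_map; apply/OK_alg/OP.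
exact/(subringX ringOK)/(OK_root Ob).
Qed.

Let eval_reduces_to0 (T : {poly R}) :
  map_poly rho T = 0 -> exists2 r, OK r & eval T = w%:A * r.
Proof.
move=> T0; have /choice[y yP] : forall i, exists y, O y /\ val T`_i = w * y.
  move=> i; have : max_ideal O (val T`_i).
    apply/(res_ker hres (subring_val _)).
    by move/(congr1 (fun p : {poly k} => p`_i)): T0; rewrite coef_map coef0.
  by case/wP=> y Oy yE; exists y.
exists (\sum_(i < size T) (y i)%:A * alpha ^+ i).
  apply: (subring_sum ringOK) => i _; apply: (subringM ringOK).
    by apply: OK_alg; case: (yP i).
  exact/(subringX ringOK)/(OK_root Ob).
rewrite /eval (@horner_coef_wide _ (size T)) ?size_poly // mulr_sumr.
apply: eq_bigr => i _; rewrite coef_map.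
rewrite [X in X * _](_ : _ = (val T`_i)%:A) // (yP i).2.
by rewrite algM mulrA.
Qed.

(** After scaling by a power of [w], the coordinates of [x] in the powers of
    [alpha] are integral and not all divisible by [w].  The polynomial they
    form is nonzero in the residue field, hence coprime to the irreducible
    [X^m - res b]; lifting a Bezout relation inverts [x] up to a principal
    unit. *)
Lemma unramified_unit_times_power x : x != 0 -> exists (t : int) (y : K),
  [/\ y != 0, OK y, OK y^-1 & x = (w ^ t)%:A * y].
Proof.
move=> x0; have [P szP xE] := adjoin_root_span m_pr alpha_nbase x.
have P0 : P != 0 by apply: contra_neq x0 => P0; rewrite xE P0 rmorph0 horner0.
have [i0 Pi0 min_i0] : exists2 i0, P`_i0 != 0
    & forall j, P`_j != 0 -> v P`_i0 <= v P`_j.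
  have lastP : ((size P).-1 < size P)%N by rewrite ltn_predL size_poly_gt0.
  have lP : P`_(Ordinal lastP) != 0 by rewrite -lead_coefE lead_coef_eq0.
  have [i Pi min_i] := @arg_minP _ _ _ (Ordinal lastP) (fun i => P`_i != 0)
    (fun i : 'I_(size P) => v P`_i) lP.
  exists i => // j Pj; have [lt_j|le_j] := ltnP j (size P).
    exact: (min_i (Ordinal lt_j)).
  by rewrite nth_default ?eqxx in Pj.
pose c := w ^ v P`_i0; have c0 : c != 0 by rewrite expfz_neq0.
have vc : v c = v P`_i0 by rewrite (dvalXz dv) // vw mulr1.
have OQ i : O (c^-1 *: P)`_i.
  rewrite coefZ; have [->|Pi] := eqVneq P`_i 0.
    by rewrite mulr0; apply: (subring0 ringO).
  apply/(dval_int dv); first by rewrite mulf_neq0 ?invr_eq0.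
  by rewrite (dvalM dv) ?invr_eq0 // (dvalV dv) // vc addrC subr_ge0 min_i0.
have [Q QE] := subring_lift_poly ringO OQ.
pose y := eval Q; have yE : y = (c^-1)%:A * x.
  by rewrite /y evalE QE map_polyZ hornerZ -xE mulr_algl.
have Oy : OK y by rewrite /y evalE QE; apply: OK_coef_eval.
pose g := map_poly rho Q.
have szg : (size g <= m)%N.
  rewrite (leq_trans (size_poly _ _)) // -(size_map_inj_poly val_inj) //.
  by rewrite QE (leq_trans (size_scale_leq _ _)).
have g0 : g != 0.
  apply/eqP=> /(congr1 (fun p : {poly k} => p`_i0)).
  rewrite coef_map coef0 => /(res_ker hres (subring_val _)).
  rewrite -[val _](coef_map val) QE coefZ mulrC => /(dval_max_ideal dv).
  by rewrite mulf_neq0 ?invr_eq0 // (dval_div dv) // vc subrr ltxx => /(_ isT).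
have /Bezout_eq1_coprimepP[[u1 u2] /= bez] :=
  coprimep_Xn_sub_nonpower card_k m_dvd chiP g0 szg.
have [[U1 U1E] [U2 U2E]] := (residue_lift_poly ringO hres u1, residue_lift_poly ringO hres u2).
pose B : R := exist _ b (asboolT Ob).
pose T := U1 * Q + U2 * ('X^m - B%:P) - 1.
have [|r Or TE] := @eval_reduces_to0 T.
  rewrite /T !(rmorphB, rmorphD, rmorphM) /= map_polyXn map_polyC rmorph1.
  by rewrite U1E U2E; apply/eqP; rewrite subr_eq0; apply/eqP; exact: bez.
have {}TE : eval U1 * y = 1 + w%:A * r.
  have hornerT (f : {rmorphism R -> K}) : (map_poly f T).[alpha] =
      (map_poly f U1).[alpha] * (map_poly f Q).[alpha]
      + (map_poly f U2).[alpha] * (alpha ^+ m - f B) - 1.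
    rewrite /T !(rmorphB, rmorphD, rmorphM) /= map_polyXn map_polyC rmorph1.
    by rewrite hornerD hornerN !hornerD !hornerM hornerD hornerN hornerXn !hornerC.
  rewrite -TE /eval hornerT [X in _ * (_ - X)](_ : _ = alpha ^+ m) ?alphaE //.
  by rewrite subrr mulr0 addr0 [RHS]addrC subrK.
have wA0 : (w%:A : K) != 0 by rewrite alg_eq0.
have [s0 OsV] : 1 + w%:A * r != 0 /\ OK (1 + w%:A * r)^-1.
  apply: (principal_unit_inv wA0 (esym (algX K w m))) => //.
  rewrite -(prednK m_gt0) exprS mulrC; apply: (dval_max_idealM dv) => //.
  exact: (subringX ringO).
have y0 : y != 0 by apply: contra_neq s0 => y0; rewrite -TE y0 mulr0.
exists (v P`_i0), y; split=> //.
  have -> : y^-1 = eval U1 * (1 + w%:A * r)^-1.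
    rewrite -TE invfM mulrA mulfV ?mul1r //.
    by apply: contra_neq s0 => U10; rewrite -TE U10 mul0r.
  apply: (subringM ringOK) OsV; rewrite evalE; apply: OK_coef_eval => i.
  by rewrite coef_map; apply: subring_val.
by rewrite yE -/c algV mulVKf // alg_eq0.
Qed.

Lemma unramified_uniformizer : uniformizer OK w%:A.
Proof.
have wA0 : (w%:A : K) != 0 by rewrite alg_eq0.
have nOV : ~ OK (w%:A)^-1.
  by rewrite -algV => /OK_base OV; apply: (max_ideal_inv w_neq0 OV).
move=> x; split=> [[Ox mx]|[y Oy ->]]; last first.
  split; first by apply: (subringM ringOK) => //; apply: OK_alg.
  have [->|wy0] := eqVneq (w%:A * y) 0; [by left|right=> OV; apply: nOV].
  have -> : (w%:A)^-1 = y * (w%:A * y)^-1.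
    rewrite invfM mulrCA mulfV ?mulr1 //.
    by apply: contra_neq wy0 => ->; rewrite mulr0.
  exact: (subringM ringOK).
have [->|x0] := eqVneq x 0.
  by exists 0; rewrite ?mulr0 //; apply: (subring0 ringOK).
have [t [y [y0 Oy OyV xE]]] := unramified_unit_times_power x0.
have t_gt0 : 0 < t.
  rewrite ltNge; apply/negP=> t_le0; case: mx => [/eqP|]; first by rewrite (negPf x0).
  apply; rewrite xE invfM -algV; apply: (subringM ringOK) => //.
  apply/OK_alg; apply/(dval_int dv); first by rewrite invr_eq0 expfz_neq0.
  by rewrite (dvalV dv) ?expfz_neq0 // (dvalXz dv) // vw mulr1 oppr_ge0.
exists ((w ^ (t - 1))%:A * y).
  apply: (subringM ringOK) => //; apply/OK_alg; apply/(dval_int dv).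
    by rewrite expfz_neq0.
  by rewrite (dvalXz dv) // vw mulr1 subr_ge0 -gtz0_ge1.
by rewrite xE mulrA -algM -{2}[w]expr1z -expfzDr // addrC subrK.
Qed.

Lemma unramified_norm_val x a : x != 0 -> norm x = a%:A ->
  exists t : int, v a = m%:Z * t.
Proof.
move=> x0 Na; have [t [y [y0 Oy OyV xE]]] := unramified_unit_times_power x0.
exists t; have [c Nc] := norm_base y; have c0 : c != 0.
  by rewrite -(alg_eq0 K) -Nc galNorm_eq0.
have vc : v c = 0.
  have NcV : norm y^-1 = (c^-1)%:A by rewrite galNormV Nc algV.
  have /(dval_int dv c0) := OK_norm Oy Nc.
  have cV0 : c^-1 != 0 by rewrite invr_eq0.
  have /(dval_int dv cV0) := OK_norm OyV NcV; rewrite (dvalV dv) // oppr_ge0.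
  by move=> le0 ge0; apply/eqP; rewrite eq_le le0.
have -> : a = (w ^ t) ^+ m * c.
  apply: (fmorph_inj (in_alg K)); rewrite /= -Na xE galNormM norm_alg Nc.
  by rewrite algM.
rewrite (dvalM dv) ?expf_neq0 ?expfz_neq0 // (dvalXn dv) ?expfz_neq0 //.
by rewrite (dvalXz dv) // vw vc mulr1 addr0.
Qed.

End UnramifiedCase.

(** * Adjoining an m-th root of a uniformizer *)

Section RamifiedCase.
Variables (alpha : K) (pi : F).
Hypotheses (m_pr : prime m) (alpha_nbase : alpha \notin 1%VS).
Hypotheses (alphaE : alpha ^+ m = pi%:A) (pi_neq0 : pi != 0) (vpi : v pi = 1).

Let pi_max : max_ideal O pi.
Proof. by apply/(dval_max_ideal dv); rewrite ?vpi. Qed.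
Let Opi : O pi. Proof. by case: pi_max. Qed.

Let alpha_neq0 : alpha != 0.
Proof. by apply: contraNneq alpha_nbase => ->; apply: mem0v. Qed.

(** The valuation of [K] for which [alpha] has value 1 takes the value
    [m * v a + i] at [a * alpha^i], and for different [i < m] these values are
    distinct, even modulo [m]. *)
Let weight_inj (a c : int) (i j : nat) : (i < m)%N -> (j < m)%N ->
  m%:Z * a + i%:Z = m%:Z * c + j%:Z -> i = j.
Proof.
move=> lti ltj E; have : (i = j %[mod m])%Z.
  by rewrite -(modzMDl a i m) -(modzMDl c j m) ![_ * m%:Z]mulrC E.
by rewrite !modz_nat !modn_small // => -[].
Qed.

Lemma ramified_leading_monomial x : x != 0 ->
  exists (c : F) (i : nat) (r : K), [/\ c != 0, (i < m)%N, OK r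
    & x = c%:A * alpha ^+ i * (1 + alpha * r)].
Proof.
move=> x0; have [P szP xE] := adjoin_root_span m_pr alpha_nbase x.
have P0 : P != 0 by apply: contra_neq x0 => P0; rewrite xE P0 rmorph0 horner0.
have lastP : ((size P).-1 < m)%N.
  by apply: leq_trans szP; rewrite ltn_predL size_poly_gt0.
have lP : P`_(Ordinal lastP) != 0 by rewrite -lead_coefE lead_coef_eq0.
have [i Pi min_i] := @arg_minP _ _ _ (Ordinal lastP) (fun i => P`_i != 0)
  (fun i : 'I_m => m%:Z * v P`_i + i%:Z) lP.
have iA0 : (P`_i)%:A * alpha ^+ i != 0 :> K.
  by rewrite mulf_neq0 ?expf_neq0 // alg_eq0.
pose s (j : 'I_m) := (P`_j / P`_i)%:A * alpha ^+ j / alpha ^+ i.+1.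
have Os j : j != i -> OK (s j).
  move=> ne_ji; have [Pj|Pj] := eqVneq P`_j 0.
    by rewrite /s Pj mul0r scale0r !mul0r; apply: (subring0 ringOK).
  have q0 : (P`_j / P`_i) ^+ m * pi ^+ j / pi ^+ i.+1 != 0.
    by rewrite !mulf_neq0 ?invr_eq0 ?expf_neq0 // mulf_neq0 ?invr_eq0.
  apply: (OK_root (a := (P`_j / P`_i) ^+ m * pi ^+ j / pi ^+ i.+1)); last first.
    by rewrite algM algV algM !algX -alphaE /s !exprMn exprVn -!exprM ![(m * _)%N]mulnC.
  apply/(dval_int dv q0).
  have Pij : P`_j / P`_i != 0 by rewrite mulf_neq0 ?invr_eq0.
  rewrite (dval_div dv) ?mulf_neq0 ?expf_neq0 //.
  rewrite (dvalM dv) ?expf_neq0 // !(dvalXn dv) // (dval_div dv) // vpi.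
  have : m%:Z * v P`_i + i%:Z < m%:Z * v P`_j + j%:Z.
    rewrite lt_neqAle min_i // andbT; apply: contra ne_ji => /eqP/weight_inj E.
    by apply/eqP/val_inj/esym/(E (ltn_ord i) (ltn_ord j)).
  rewrite !mulr1 mulrBr; move: (m%:Z * v P`_i) (m%:Z * v P`_j) => A B.
  by move: (nat_of_ord i) (nat_of_ord j) => i' j'; clear; lia.
exists P`_i, (i : nat), (\sum_(j < m | j != i) s j); split=> //.
  exact: (subring_sum ringOK).
rewrite xE (@horner_coef_wide _ m) ?size_map_poly // (bigD1 i) //= coef_map /=.
rewrite mulrDr mulr1; congr (_ + _); rewrite mulrA mulr_sumr.
apply: eq_bigr => j _; rewrite coef_map /s /= algM algV exprS.
by field; rewrite alpha_neq0 alg_eq0 Pi expf_neq0.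
Qed.

Lemma ramified_not_unramified : ~ unramified O K.
Proof.
move=> /(_ pi); have upi : uniformizer O pi by apply/(dval_uniformizer dv).
move=> /(_ upi alpha) [/= + _].
have Oalpha : OK alpha := OK_root Opi alphaE.
case=> [|y Oy yE].
  split=> //; right=> OV; apply: (max_ideal_inv pi_neq0 _ pi_max).
  by apply: OK_base; rewrite algV -alphaE -exprVn; apply: (subringX ringOK).
have ym : y ^+ m = (pi / pi ^+ m)%:A.
  by rewrite algM algV algX -{1}alphaE yE exprMn mulrAC mulfV ?mul1r //
    expf_neq0 // alg_eq0.
have Oq : O (pi / pi ^+ m) by apply: OK_base; rewrite -ym; apply: (subringX ringOK).
have q0 : pi / pi ^+ m != 0 by rewrite mulf_neq0 ?invr_eq0 ?expf_neq0.
move/(dval_int dv q0): Oq; rewrite (dval_div dv) ?expf_neq0 // (dvalXn dv) // vpi.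
by rewrite mulr1 subr_ge0 lez_nat leqNgt (prime_gt1 m_pr).
Qed.

(** The norm of [c * alpha^i] is [c^m * pi^i] and the remaining factor has a
    principal unit as norm; valuation 0 forces [i = 0]. *)
Lemma ramified_norm_residue (k : finFieldType) (res : F -> k) x a :
    is_residue_field O res -> x != 0 -> norm x = a%:A -> v a = 0 ->
  exists2 c, c != 0 & res a = c ^+ m.
Proof.
move=> hres x0 Na va; have [c [i [r [c0 lti Or xE]]]] := ramified_leading_monomial x0.
have [z zm Nz] := norm_principal_unit alpha_neq0 alphaE pi_max Or.
have aE : a = c ^+ m * pi ^+ i * (1 + z).
  apply: (fmorph_inj (in_alg K)); rewrite /= -Na xE !galNormM norm_alg Nz.
  by rewrite galNormX (norm_root alpha_neq0 alphaE) !algM !algX.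
have [z1 Oz1 OzV] := dval_one_plus dv zm; have zV1 : (1 + z)^-1 != 0 by rewrite invr_eq0.
have vz : v (1 + z) = 0.
  move/(dval_int dv z1): Oz1; move/(dval_int dv zV1): OzV.
  by rewrite (dvalV dv) // oppr_ge0 => le0 ge0; apply/eqP; rewrite eq_le le0.
move: va; rewrite aE !(dvalM dv) ?mulf_neq0 ?expf_neq0 // vz !(dvalXn dv) // vpi.
rewrite addr0 mulr1 => va.
have i0 : i = 0%N by apply: (@weight_inj (v c) 0 i 0) => //; rewrite va mulr0.
have vc : v c = 0.
  move/eqP: va; rewrite i0 addr0 mulf_eq0 -[m%:Z == 0]/(m == 0%N) eqn0Ngt m_gt0.
  by move/eqP.
have [Oc OcV] : O c /\ O c^-1.
  have cV0 : c^-1 != 0 by rewrite invr_eq0.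
  by rewrite (dval_int dv c0) (dval_int dv cV0) (dvalV dv) // vc oppr0.
exists (res c).
  by apply/eqP=> /(res_ker hres Oc); apply: max_ideal_inv.
have Om : O (c ^+ m) by apply: (subringX ringO).
rewrite i0 expr0 mulr1 (resM hres) // (resD hres (subring1 ringO)); last by case: zm.
have /(res_ker hres) -> := zm; last by case: zm.
rewrite (res1 hres) addr0 mulr1.
elim: (m) => [|l IHl]; first by rewrite !expr0 (res1 hres).
by rewrite !exprS (resM hres) ?IHl //; apply: (subringX ringO).
Qed.

End RamifiedCase.

End TameExtension.

(** * Norm groups and their representatives *)

Lemma prime_primitive_root (R : nzRingType) (m : nat) (x : R) :
  prime m -> x ^+ m = 1 -> x != 1 -> m.-primitive_root x.
Proof.
move=> m_pr xm x1; have [l lP] := prim_order_exists (prime_gt0 m_pr) xm.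
case/(primeP m_pr).2/pred2P=> l_eq; last by rewrite -l_eq.
by move: (prim_expr_order lP); rewrite l_eq expr1 => /eqP; rewrite (negPf x1).
Qed.

(** This treats the three cases of the theorem alike: the classes of the powers
    of one element [e] exhaust the quotient, and [e] has order [m] in it. *)
Lemma represents_powers (F : fieldType) (m : nat) (N : F -> Prop) (e : F) :
    (0 < m)%N -> e != 0 ->
    (forall a b, N a -> N b -> N (a * b)) -> (forall a, N a -> N a^-1) ->
    N (e ^+ m) -> (forall i, N (e ^+ i) -> (m %| i)%N) ->
    (forall x, x != 0 -> exists i : nat, N (x / e ^+ i)) ->
  represents (fun c => exists2 i : nat, (i < m)%N & c = e ^+ i) N.
Proof.
move=> m0 e0 NM NV Nem Ndvd Nex; have eX0 i : e ^+ i != 0 by rewrite expf_neq0.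
have Nemq q : N ((e ^+ m) ^+ q).
  elim: q => [|q IHq]; last by rewrite exprS; apply: NM.
  by rewrite expr0 -(mulfV (eX0 m)); apply/NM/NV.
split=> [_ [i _ ->] //|x x0]; have [i Ni] := Nex x x0.
have Nim : N (x / e ^+ (i %% m)).
  have -> : x / e ^+ (i %% m) = x / e ^+ i * (e ^+ m) ^+ (i %/ m); last exact: NM.
  rewrite {2}(divn_eq i m) exprD -exprM [(m * _)%N]mulnC.
  by field; rewrite !eX0.
have lt_im : (i %% m < m)%N by rewrite ltn_mod.
move: (i %% m)%N Nim lt_im => {Ni}i Ni lti.
exists (e ^+ i); split=> [|_ [[l ltl ->] Nl]]; first by split; first by exists i.
have uniq_le a b : (a <= b < m)%N -> N (x / e ^+ a) -> N (x / e ^+ b) -> a = b.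
  case/andP=> leab ltb Na Nb; have : N (e ^+ (b - a)).
    have -> : e ^+ (b - a) = x / e ^+ a * (x / e ^+ b)^-1; last exact/NM/NV.
    by rewrite -[in RHS](subnK leab) exprD; field; rewrite x0 !eX0.
  move/Ndvd; have [|/dvdn_leq le_m /le_m] := posnP (b - a)%N; first by lia.
  by lia.
congr (e ^+ _); have [le_il|/ltnW le_li] := leqP i l.
  by apply: uniq_le; rewrite // le_il.
by apply/esym/uniq_le; rewrite // le_li.
Qed.

Lemma eq_represents (F : fieldType) (C D N : F -> Prop) :
  (forall c, C c <-> D c) -> represents C N -> represents D N.
Proof.
by move=> CD; have -> : C = D by apply/funext=> c; apply/propext/CD.
Qed.

(** Reduction is injective on roots of unity of order prime to the residual
    characteristic: [1 + x + ... + x^(l-1)] reduces to [l], which is not 0. *)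
Lemma residue_root_of_unity (F : fieldType) (O : F -> Prop) (k : finFieldType)
    (res : F -> k) (l : nat) (x : F) :
    subring O -> is_residue_field O res -> l%:R != 0 :> k ->
  O x -> x ^+ l = 1 -> res x = 1 -> x = 1.
Proof.
move=> ringO hres l0 Ox xl rx; apply/eqP; rewrite -subr_eq0.
have : (x - 1) * \sum_(i < l) x ^+ i = 0 by rewrite -subrX1 xl subrr.
move/eqP; rewrite mulf_eq0 => /orP[//|/eqP sum0].
pose X : subring_type ringO := exist _ x (asboolT Ox).
have : \sum_(i < l) X ^+ i = 0.
  apply: val_inj; rewrite rmorph0 -[RHS]sum0 rmorph_sum.
  by apply: eq_bigr => i _; rewrite rmorphXn.
move/(congr1 (residue_morph hres)); rewrite rmorph0 rmorph_sum.
rewrite (eq_bigr (fun=> 1)) => [|i _].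
  by move/eqP; rewrite sumr_const card_ord (negPf l0).
by rewrite rmorphXn /= /residue_morph /= rx expr1n.
Qed.

Lemma finField_card_natr (k : finFieldType) : #|k|%:R = 0 :> k.
Proof.
by rewrite -cardsT -FinRing.zmodXgE expg_cardG ?inE.
Qed.

Section NormGroup.
Variables (F : fieldType) (K : splittingFieldType F).
Local Notation N := (norm_group K).

Lemma norm_groupM a b : N a -> N b -> N (a * b).
Proof.
move=> [x x0 Nx] [y y0 Ny]; exists (x * y); first by rewrite mulf_neq0.
by rewrite galNormM Nx Ny algM.
Qed.

Lemma norm_groupV a : N a -> N a^-1.
Proof.
move=> [x x0 Nx]; exists x^-1; first by rewrite invr_eq0.
by rewrite galNormV Nx algV.
Qed.

Lemma norm_groupXn a n : N a -> N (a ^+ n).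
Proof.
move=> [x x0 Nx]; exists (x ^+ n); first by rewrite expf_neq0.
by rewrite galNormX Nx algX.
Qed.

Lemma norm_groupXz a (n : int) : N a -> N (a ^ n).
Proof.
move=> Na; case: n => n; first exact: norm_groupXn.
by rewrite NegzE -invr_expz; apply/norm_groupV/norm_groupXn.
Qed.

End NormGroup.

(** By Hilbert 90 a primitive root of unity, whose norm is 1, has the form
    [alpha / s alpha] with [s] a generator of the Galois group. *)
Lemma kummer_generator (F : fieldType) (m : nat) (zeta : F) (K : splittingFieldType F) :
    prime m -> m.-primitive_root zeta -> galois 1 {:K} ->
    cyclic 'Gal({:K} / 1) -> \dim {:K} = m ->
  exists (alpha : K) (b : F),
    [/\ alpha != 0, alpha \notin 1%VS & alpha ^+ m = b%:A].
Proof.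
move=> m_pr zP hgal /cyclicP[s defG] hdeg.
have gen : generator 'Gal({:K} / 1)%g s by rewrite /generator defG.
have Nz : galNorm 1 {:K} (zeta%:A : K) == 1.
  by rewrite (norm_alg hgal hdeg) (prim_expr_order zP) scale1r.
have [al [_ al0] zE] := elimT (Hilbert's_theorem_90 gen (memvf _)) Nz.
have sal0 : s al != 0 by rewrite fmorph_eq0.
have alE : al = zeta%:A * s al by rewrite zE divfK.
have zm : (zeta%:A : K) ^+ m = 1.
  by rewrite -algX (prim_expr_order zP) scale1r.
have sm : s (al ^+ m) = al ^+ m.
  by rewrite [in RHS]alE exprMn zm mul1r rmorphXn.
have : al ^+ m \in fixedField 'Gal({:K} / 1)%g.
  apply/fixedFieldP; rewrite ?memvf // => x; rewrite defG => /cycleP[i ->].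
  elim: i => [|i IHi]; first by rewrite expg0 gal_id.
  by rewrite expgS galM ?memvf // sm.
rewrite (galois_fixedField hgal) => /vlineP[b alm].
exists al, b; split=> //; apply/negP=> /vlineP[a aE].
have z1 : (zeta%:A : K) = 1 by rewrite zE aE gal_alg mulfV // -aE.
have := prim_order_dvd zP 1; rewrite expr1 dvdn1 gtn_eqF ?prime_gt1 //.
by rewrite -(fmorph_eq1 (in_alg K)) /= z1 eqxx.
Qed.

Section NormResidues.
Variables (F : fieldType) (O : F -> Prop) (v : F -> int).
Hypothesis dv : discrete_valuation O v.
Variables (k : finFieldType) (res : F -> k) (n m : nat).
Hypotheses (hres : is_residue_field O res) (card_k : #|k| = n.+1).
Hypotheses (m_pr : prime m) (m_odd : odd m) (m_dvd : (m %| n)%N).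
Hypothesis root_one_plus : forall z, max_ideal O z -> exists l, l ^+ m = 1 + z.
Variables (zeta w : F) (K : splittingFieldType F).
Hypotheses (zetaP : m.-primitive_root zeta) (wP : uniformizer O w).
Hypotheses (hgal : galois 1 {:K}) (hcyc : cyclic 'Gal({:K} / 1)).
Hypothesis hdeg : \dim {:K} = m.

Local Notation r := (n %/ m)%N.
Local Notation N := (norm_group K).

Let ringO : subring O := dval_ring dv.
Let m_gt0 : (0 < m)%N := prime_gt0 m_pr.
Let w_neq0 : w != 0. Proof. by case/(dval_uniformizer dv): wP. Qed.
Let vw : v w = 1. Proof. by case/(dval_uniformizer dv): wP. Qed.

Lemma dval0_unit u : u != 0 -> v u = 0 -> O u /\ O u^-1.
Proof.
move=> u0 vu; have uV0 : u^-1 != 0 by rewrite invr_eq0.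
by rewrite (dval_int dv u0) (dval_int dv uV0) (dvalV dv) // vu oppr0.
Qed.

Lemma dval0_residue u : u != 0 -> v u = 0 -> res u != 0.
Proof.
move=> u0 vu; have [Ou OuV] := dval0_unit u0 vu.
by apply/eqP=> /(res_ker hres Ou); apply: max_ideal_inv.
Qed.

Lemma residueX u i : O u -> res (u ^+ i) = res u ^+ i.
Proof.
move=> Ou; elim: i => [|i IHi]; first by rewrite !expr0 (res1 hres).
by rewrite !exprS (resM hres) ?IHi //; apply: (subringX ringO).
Qed.

Lemma residueV u : u != 0 -> v u = 0 -> res u^-1 = (res u)^-1.
Proof.
move=> u0 vu; have [Ou OuV] := dval0_unit u0 vu.
have ru0 := dval0_residue u0 vu.
by apply: (mulfI ru0); rewrite -(resM hres) // !mulfV // (res1 hres).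
Qed.

(** Lift an [m]-th root from the residue field; the quotient is a principal
    unit. *)
Lemma unit_power u : u != 0 -> v u = 0 -> res u ^+ r = 1 ->
  exists2 c, c != 0 & u = c ^+ m.
Proof.
move=> u0 vu ur; have [Ou OuV] := dval0_unit u0 vu.
have [d dE] := finField_residue_is_power card_k m_dvd (dval0_residue u0 vu) ur.
have [t Ot tE] := res_surj hres d.
have d0 : d != 0.
  by apply: contraNneq (dval0_residue u0 vu) => d0; rewrite -dE d0 expr0n eqn0Ngt m_gt0.
have [t0 OtV] : t != 0 /\ O t^-1 by apply: (residue_unit ringO hres); rewrite ?tE.
have tm0 : t ^+ m != 0 by rewrite expf_neq0.
have Oq : O (u / t ^+ m).
  by apply: (subringM ringO) => //; rewrite -exprVn; apply: (subringX ringO).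
have rq : res (u / t ^+ m) = 1.
  apply: (mulfI (expf_neq0 m d0)); rewrite mulr1 -tE -residueX //.
  rewrite -(resM hres) //; last exact: (subringX ringO).
  by rewrite mulrC divfK // residueX // tE dE.
have [l lE] : exists l, l ^+ m = 1 + (u / t ^+ m - 1).
  apply: root_one_plus.
  have Oq1 : O (u / t ^+ m - 1) by apply: (subringB ringO (y := 1)) => //; apply: (subring1 ringO).
  apply/(res_ker hres Oq1).
  have := resD hres Oq1 (subring1 ringO); rewrite subrK rq (res1 hres).
  by move/eqP; rewrite -subr_eq subrr eq_sym => /eqP.
have uE : u = (t * l) ^+ m by rewrite exprMn lE addrC subrK mulrC divfK.
exists (t * l) => //; apply: contra_neq u0 => tl0.
by rewrite uE tl0 expr0n eqn0Ngt m_gt0.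
Qed.

Lemma norm_group_power c : c != 0 -> N (c ^+ m).
Proof.
move=> c0; exists c%:A; first by rewrite alg_eq0.
exact: norm_alg.
Qed.

(** Two units whose images in the cyclic group of order [m] of [m]-th power
    residue classes agree differ by an [m]-th power. *)
Lemma unit_norm_class e u : e != 0 -> v e = 0 -> m.-primitive_root (res e ^+ r) ->
  u != 0 -> v u = 0 -> exists2 i : nat, (i < m)%N & N (u / e ^+ i).
Proof.
move=> e0 ve eP u0 vu; have [Oe OeV] := dval0_unit e0 ve.
have ru0 := dval0_residue u0 vu; have re0 := dval0_residue e0 ve.
have urm : (res u ^+ r) ^+ m = 1.
  by rewrite -exprM divnK // (finField_pow_pred card_k).
have [i iE] := prim_rootP eP urm; exists i => //.
have eX0 : e ^+ i != 0 by rewrite expf_neq0.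
have veX : v (e ^+ i) = 0 by rewrite (dvalXn dv) // ve mulr0.
have [c c0 ->] : exists2 c, c != 0 & u / e ^+ i = c ^+ m.
  apply: unit_power; rewrite ?mulf_neq0 ?invr_eq0 ?(dval_div dv) ?vu ?veX ?subrr //.
  have [[Ou OuV] [OX OXV]] := (dval0_unit u0 vu, dval0_unit eX0 veX).
  rewrite (resM hres) // residueV // residueX // exprMn exprVn iE -!exprM.
  by rewrite mulnC mulfV // expf_neq0.
exact: norm_group_power.
Qed.

(** A Kummer generator may be changed by powers prime to [m] and by factors in
    [F].  If [m] divides the valuation of its [m]-th power, that power can be
    made a unit [b], which is not an [m]-th power in the residue field, as
    otherwise [alpha] would lie in [F].  If not, a Bezout relation makes it a
    uniformizer.  By [unramified_uniformizer] and [ramified_not_unramified] these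
    are the unramified and the ramified case. *)
Lemma kummer_dichotomy : exists (alpha : K) (b : F),
  [/\ alpha \notin 1%VS, alpha ^+ m = b%:A, b != 0 &
      (v b = 0 /\ m.-primitive_root (res b ^+ r)) \/ v b = 1].
Proof.
have [al [b [al0 nal alE]]] := kummer_generator m_pr zetaP hgal hcyc hdeg.
have b0 : b != 0 by rewrite -(alg_eq0 K) -alE expf_neq0.
have wXA (t : int) : (w ^ t)%:A ^+ m = (w ^ (t * m%:Z))%:A :> K.
  by rewrite -algX exprnP exprz_exp.
have [/dvdzP[t vb]|ndvd] := boolP (m%:Z %| v b)%Z.
  pose c := b * w ^ (- t * m%:Z).
  have c0 : c != 0 by rewrite mulf_neq0 ?expfz_neq0.
  have vc : v c = 0.
    by rewrite (dvalM dv) ?expfz_neq0 // (dvalXz dv) // vw vb mulr1 mulNr subrr.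
  have alcE : (al * (w ^ (- t))%:A) ^+ m = c%:A by rewrite exprMn alE wXA -algM.
  have nalc : al * (w ^ (- t))%:A \notin 1%VS.
    apply: contra nal => /vlineP[a aE]; apply/vlineP; exists (a * w ^ t).
    rewrite algM -aE -mulrA -algM -expfzDr // addNr expr0z.
    by rewrite scale1r mulr1.
  exists (al * (w ^ (- t))%:A), c; split=> //; left; split=> //.
  apply: prime_primitive_root => //.
    by rewrite -exprM divnK // (finField_pow_pred card_k) // dval0_residue.
  apply: contra nalc => /eqP/(unit_power c0 vc)[d d0 cE].
  have dA0 : (d%:A : K) != 0 by rewrite alg_eq0.
  have [|o _ oE] := root_of_unity_base zetaP (z := al * (w ^ (- t))%:A / d%:A).
    by rewrite exprMn alcE exprVn -algX -cE mulfV // alg_eq0.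
  by apply/vlineP; exists (o * d); rewrite algM -oE divfK.
have cop : coprimez (v b) m%:Z.
  by rewrite coprimezE coprime_sym prime_coprime.
have [[s t] /= st] := coprimezP _ _ cop.
pose c := b ^ s * w ^ (t * m%:Z).
have c0 : c != 0 by rewrite mulf_neq0 ?expfz_neq0.
have vc : v c = 1.
  rewrite (dvalM dv) ?expfz_neq0 // !(dvalXz dv) // vw mulr1 -st.
  by rewrite mulrC [t * _]mulrC.
have cE : (al ^ s * (w ^ t)%:A) ^+ m = c%:A.
  rewrite exprMn wXA algM; congr (_ * _).
  by rewrite exprnP exprzAC -exprnP alE algXz.
exists (al ^ s * (w ^ t)%:A), c; split=> //; last by right.
apply/negP=> /vlineP[a aE]; have aM : a ^+ m = c.
  by apply: (@alg_inj _ K); rewrite algX -aE.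
have a0 : a != 0 by apply: contra_neq c0 => a0; rewrite -aM a0 expr0n eqn0Ngt m_gt0.
move: vc; rewrite -aM (dvalXn dv) // => /(congr1 absz); rewrite abszM /=.
move/eqP; rewrite muln_eq1 => /andP[m1 _].
by move: (prime_gt1 m_pr); rewrite (eqP m1).
Qed.

(** Units are norms since [b], the norm of [alpha], generates the units modulo
    [m]-th powers; and the valuations of norms are multiples of [m]. *)
Lemma represents_unramified :
  unramified O K ->
  represents (fun c : F => exists2 i : nat, (i < m)%N & c = w ^+ i) N.
Proof.
move=> unr; have [al [b [nal alE b0 [[vb bP]|vb]]]] := kummer_dichotomy; last first.
  by case: (ramified_not_unramified dv zetaP m_pr alE b0 vb).
have [Ob ObV] := dval0_unit b0 vb.
have al0 : al != 0 by apply: contraNneq nal => ->; apply: mem0v.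
have Nb : N b by exists al => //; exact: (norm_root zetaP m_odd hgal hdeg al0 alE).
apply: represents_powers => //.
- exact: norm_groupM.
- exact: norm_groupV.
- exact: norm_group_power.
- move=> i [x x0 Nx].
  have [t] := unramified_norm_val dv zetaP hgal hdeg hres card_k m_dvd m_pr
    nal alE Ob bP wP x0 Nx.
  rewrite (dvalXn dv) // vw mulr1 => iE; apply/dvdnP; exists `|t|%N.
  by have := congr1 absz iE; rewrite abszM mulnC.
move=> x x0; pose u := x / w ^ v x.
have wv0 : w ^ v x != 0 by rewrite expfz_neq0.
have u0 : u != 0 by rewrite mulf_neq0 ?invr_eq0.
have vu : v u = 0 by rewrite (dval_div dv) // (dvalXz dv) // vw mulr1 subrr.
exists `|(v x %% m)%Z|%N.
have wE : w ^ v x = (w ^ (v x %/ m)%Z) ^+ m * w ^+ `|(v x %% m)%Z|%N.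
  have m_neq0 : m%:Z != 0 by rewrite eqz_nat -lt0n.
  rewrite {1}(divz_eq (v x) m) expfzDr // -exprz_exp; congr (_ * _).
  by rewrite [RHS]exprnP gez0_abs // modz_ge0.
have -> : x / w ^+ `|(v x %% m)%Z|%N = (w ^ (v x %/ m)%Z) ^+ m * u.
  by rewrite /u wE; field; rewrite !expf_neq0 ?expfz_neq0.
apply: norm_groupM; first by apply: norm_group_power; rewrite expfz_neq0.
have [i _ Ni] := unit_norm_class b0 vb bP u0 vu.
rewrite -(divfK (expf_neq0 i b0) u); apply: norm_groupM => //.
exact: norm_groupXn.
Qed.

(** The norm group contains the uniformizer [b] and meets the units in the
    elements that are [m]-th powers in the residue field.  Hence any unit of
    order [m] modulo such elements gives representatives. *)
Lemma represents_ramified (e : F) :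
  ~ unramified O K -> e != 0 -> v e = 0 -> m.-primitive_root (res e ^+ r) ->
  represents (fun c : F => exists2 i : nat, (i < m)%N & c = e ^+ i) N.
Proof.
move=> ram e0 ve eP; have [al [b [nal alE b0 [[vb bP]|vb]]]] := kummer_dichotomy.
  have [Ob ObV] := dval0_unit b0 vb; case: ram => w' w'P.
  exact: (unramified_uniformizer dv zetaP hgal hdeg hres card_k m_dvd m_pr
    nal alE Ob bP w'P).
have al0 : al != 0 by apply: contraNneq nal => ->; apply: mem0v.
have Nb : N b by exists al => //; exact: (norm_root zetaP m_odd hgal hdeg al0 alE).
have [Oe OeV] := dval0_unit e0 ve.
apply: represents_powers => //.
- exact: norm_groupM.
- exact: norm_groupV.
- exact: norm_group_power.
- move=> i [x x0 Nx].
  have [|c c0] := ramified_norm_residue dv zetaP m_odd hgal hdeg m_pr nal alE b0 vb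
    hres x0 Nx; first by rewrite (dvalXn dv) // ve mulr0.
  rewrite residueX // => ic; rewrite (prim_order_dvd eP) exprAC ic.
  by rewrite (finField_power_residue card_k m_dvd c0).
move=> x x0; pose u := x / b ^ v x.
have bv0 : b ^ v x != 0 by rewrite expfz_neq0.
have u0 : u != 0 by rewrite mulf_neq0 ?invr_eq0.
have vu : v u = 0 by rewrite (dval_div dv) // (dvalXz dv) // vb mulr1 subrr.
have [i _ Ni] := unit_norm_class e0 ve eP u0 vu; exists i.
have -> : x / e ^+ i = b ^ v x * (u / e ^+ i).
  by rewrite /u; field; rewrite bv0 expf_neq0.
by apply: norm_groupM => //; apply: norm_groupXz.
Qed.

End NormResidues.
Theorem proposition5p6
  (F : fieldType) (O : F -> Prop) (hF : local_field O)
  (varpi : F) (hvarpi : uniformizer O varpi)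
  (k : finFieldType) (res : F -> k) (hres : is_residue_field O res)
  (p : nat) (hp : p \in [pchar k])
  (q : nat) (hq : q = #|k|)
  (Fbar : closedFieldType) (j : {rmorphism F -> Fbar})
  (hFbar : is_alg_closure j)
  (m : nat) (hm : prime m) (hodd : odd m) (hmp : m <> p)
  (hmu : forall z : Fbar, z ^+ m = 1 -> exists x : F, j x = z)
  (K : splittingFieldType F)
  (hgal : galois 1 {:K}) (hcyc : cyclic 'Gal({:K} / 1))
  (hdeg : \dim {:K} = m) :
  [/\ unramified O K ->
        represents (fun c : F => exists2 i : nat, (i < m)%N & c = varpi ^+ i)
                   (norm_group K),
      ~ unramified O K -> ~~ (m ^ 2 %| q - 1)%N ->
        represents (fun c : F => c ^+ m = 1) (norm_group K)
    & ~ unramified O K -> (m ^ 2 %| q - 1)%N ->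
        forall xi : F, (q - 1)%N.-primitive_root xi ->
        represents (fun c : F => exists2 i : nat, (i < m)%N & c = xi ^+ i)
                   (norm_group K)].
Proof.
have k_gt1 := finNzRing_gt1 k.
have card_k : #|k| = (q - 1).+1 by rewrite hq subn1 prednK // ltnW.
have p_pr : prime p := pcharf_prime hp.
have km0 : m%:R != 0 :> k.
  by rewrite -(dvdn_pcharf hp) dvdn_prime2 //; apply/eqP => pm; apply: hmp.
have m_gt0 := prime_gt0 hm.
have [[v dv] root_one_plus] := local_field_structure hF hvarpi hres m_gt0 km0.
have ringO := dval_ring dv.
have [Fm0 _] : m%:R != 0 :> F /\ O m%:R^-1.
  apply: (residue_unit ringO hres); first exact: subring_nat.
  by rewrite (residue_nat ringO hres).
have [zeta zetaP] : exists zeta : F, m.-primitive_root zeta.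
  have [z] : exists z : Fbar, root (\poly_(i < m) 1) z.
    apply/closed_rootP; rewrite size_poly_eq ?oner_neq0 //.
    by rewrite gtn_eqF ?prime_gt1.
  rewrite /root horner_poly (eq_bigr (fun i : 'I_m => z ^+ i)) => [|i _]; last first.
    by rewrite mul1r.
  move=> /eqP sum0; have zm : z ^+ m = 1.
    by apply/eqP; rewrite -subr_eq0 subrX1 sum0 mulr0.
  have [x jx] := hmu z zm; exists x; apply: prime_primitive_root => //.
    by apply: (fmorph_inj j); rewrite rmorphXn jx zm rmorph1.
  apply: contra_neq Fm0 => x1; apply: (fmorph_inj j); rewrite rmorph_nat rmorph0.
  rewrite -[RHS]sum0 -jx x1 rmorph1 (eq_bigr (fun=> 1)) ?sumr_const ?card_ord //.
  by move=> i _; rewrite expr1n.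
have unity_unit l x : (0 < l)%N -> x ^+ l = 1 -> [/\ x != 0, O x & v x = 0].
  move=> l0 xl; have x0 : x != 0.
    by apply: contra_eq_neq xl => ->; rewrite expr0n eqn0Ngt l0 eq_sym oner_neq0.
  split=> //; first by apply: (dval_int_root dv l0); rewrite xl; apply: subring1.
  have /eqP := dvalXn dv l x0; rewrite xl (dval1 dv) eq_sym mulf_eq0.
  by rewrite eqz_nat eqn0Ngt l0 => /eqP.
have [zeta0 Ozeta vzeta] := unity_unit m zeta m_gt0 (prim_expr_order zetaP).
have rzetaP : m.-primitive_root (res zeta).
  apply: prime_primitive_root => //.
    by rewrite -(residueX dv hres) // (prim_expr_order zetaP) (res1 hres).
  apply/eqP=> rz1.
  have := residue_root_of_unity ringO hres km0 Ozeta (prim_expr_order zetaP) rz1.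
  move=> z1; have := prim_order_dvd zetaP 1.
  by rewrite z1 expr1n eqxx dvdn1 gtn_eqF ?prime_gt1.
have m_dvd : (m %| q - 1)%N.
  rewrite (prim_order_dvd rzetaP) (finField_pow_pred card_k) //.
  exact: (dval0_residue dv hres zeta0 vzeta).
have ram := represents_ramified dv hres card_k hm hodd m_dvd root_one_plus zetaP
  hvarpi hgal hcyc hdeg.
split=> [unr|nunr ndvd|nunr _ xi xiP].
- exact: (represents_unramified dv hres card_k hm hodd m_dvd root_one_plus zetaP).
(* As [m^2] does not divide [q - 1], [m] does not divide [(q - 1) / m], so the
   [(q - 1) / m]-th power of the residue of [zeta] still has order [m]. *)
- apply: eq_represents (ram zeta nunr zeta0 vzeta _) => [c|].
    split=> [[i _ ->]|/(prim_rootP zetaP)[i ->]]; last by exists i.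
    by rewrite exprAC (prim_expr_order zetaP) expr1n.
  apply: prime_primitive_root => //.
    by rewrite exprAC (prim_expr_order rzetaP) expr1n.
  rewrite -(prim_order_dvd rzetaP); apply: contra ndvd => m_dvd_r.
  by rewrite -(divnK m_dvd) expnS expn1 dvdn_mul.
have n_gt0 := prim_order_gt0 xiP.
have [xi0 Oxi vxi] := unity_unit _ xi n_gt0 (prim_expr_order xiP).
apply: ram => //; apply: prime_primitive_root => //.
  rewrite -exprM divnK // (finField_pow_pred card_k) //.
  exact: (dval0_residue dv hres xi0 vxi).
rewrite -(residueX dv hres) //; apply/eqP=> rxi1.
have kn0 : (q - 1)%:R != 0 :> k.
  have : #|k|%:R = 0 :> k := finField_card_natr k.
  by rewrite card_k -natr1 => /eqP; rewrite addr_eq0 => /eqP->; rewrite oppr_eq0 oner_neq0.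
have xir : xi ^+ ((q - 1) %/ m) = 1.
  apply: (residue_root_of_unity ringO hres kn0) rxi1.
    exact: (subringX ringO).
  by rewrite exprAC (prim_expr_order xiP) expr1n.
move/eqP: xir; rewrite -(prim_order_dvd xiP) => /dvdn_leq.
rewrite divn_gt0 ?(dvdn_leq n_gt0 m_dvd) // => /(_ isT).
by rewrite leqNgt ltn_Pdiv ?prime_gt1.
Qed.
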